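(* Let $H_1,H_2,K_1,K_2$ be Hilbert $\mathfrak{A}$-modules and let $$A=\begin{pmatrix} A_{11} & A_{12} \\ A_{21} & A_{22}\end{pmatrix}\in\mathcal{L}(H_1\oplus H_2,K_1\oplus K_2).$$ Put $$E=AA^*=\begin{pmatrix} E_{11} & E_{12} \\ E_{12}^* & E_{22}\end{pmatrix}\in\mathcal{L}(K_1\oplus K_2).$$ Suppose that $(A_{11},A_{12})\in\mathcal{L}(H_1\oplus H_2,K_1)$ has a closed range (so that $E_{11}^\dag$ exists), let $S(E)=E_{22}-E_{12}^*E_{11}^\dag E_{12}$, and suppose further that both $A$ and $S(E)$ have closed ranges. Then $$A^\dag=A^*\Big[\mathrm{diag}(E_{11}^\dag,0)\,X_R(E)+F_1(E)\,S(E)^g\,F_1(E)^*\Big],$$ where $$F_1(E)=\binom{-E_{11}^\dag E_{12}}{I_{K_2}}\in\mathcal{L}(K_2,K_1\oplus K_2),$$ $$S(E)^g=S(E)^\dag_{[F_1(E)^*F_1(E)]^{-1},\,F_1(E)^*F_1(E)}\in\mathcal{L}(K_2),$$ $$X_R(E)=I_{K_1\oplus K_2}-\big(F_1(E)^*\big)^\dag\big(I_{K_2}-S(E)S(E)^g\big)F_1(E)^*\in\mathcal{L}(K_1\oplus K_2).$$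
   Context: $\mathfrak{A}$ is a $C^*$-algebra. For Hilbert $\mathfrak{A}$-modules $H,K$, $\mathcal{L}(H,K)$ is the set of adjointable operators from $H$ to $K$, $\mathcal{L}(H)=\mathcal{L}(H,H)$, and $I_H$ is the identity. $H_1\oplus H_2$ is the Hilbert $\mathfrak{A}$-module of column pairs with inner product $\langle \binom{x_1}{y_1},\binom{x_2}{y_2}\rangle=\langle x_1,x_2\rangle+\langle y_1,y_2\rangle$. In block matrices, the $(i,j)$ block is an adjointable operator from the $j$-th summand of the domain to the $i$-th summand of the codomain; $(A_{11},A_{12})$ is $\binom{h_1}{h_2}\mapsto A_{11}h_1+A_{12}h_2$. An operator in $\mathcal{L}(K)$ is called positive definite if it is positive and invertible in $\mathcal{L}(K)$. For $T\in\mathcal{L}(H,K)$ and positive definite $M\in\mathcal{L}(K)$, $N\in\mathcal{L}(H)$, the weighted Moore-Penrose inverse $T^\dag_{MN}$ (also written $T^\dag_{M,N}$) is the (unique if it exists) $X\in\mathcal{L}(K,H)$ with $TXT=T$, $XTX=X$, $(MTX)^*=MTX$, $(NXT)^*=NXT$; it exists if and only if the range of $T$ is closed. $T^\dag$ denotes $T^\dag_{MN}$ with $M=I_K$, $N=I_H$. The operator $F_1(E)^*F_1(E)$ is positive definite and $F_1(E)^*$ has a Moore-Penrose inverse. *)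

(* Defs.v *)
From HB Require Import structures.
From mathcomp Require Import all_boot all_order all_algebra complex.
From mathcomp Require Import all_classical all_reals all_analysis.

Set Implicit Arguments.
Unset Strict Implicit.
Unset Printing Implicit Defensive.

Import Order.TTheory GRing.Theory Num.Theory numFieldNormedType.Exports.

Local Open Scope ring_scope.

(* C*-algebras, not assumed unital: the product is a separate operation [cmul],
   since a ring structure would provide a unit. The Banach space structure is
   the one of [completeNormedModType R[i]]. *)
HB.mixin Record isCStarAlgebra (R : realType) (A : Type)
    of CompleteNormedModule R[i] A := {
  cmul : A -> A -> A ;
  cstar : A -> A ;
  cmulA : forall a b c, cmul a (cmul b c) = cmul (cmul a b) c ;
  cmulDl : forall a b c, cmul (a + b) c = cmul a c + cmul b c ;
  cmulDr : forall a b c, cmul a (b + c) = cmul a b + cmul a c ;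
  cmulZl : forall (z : R[i]) a b, cmul (z *: a) b = z *: cmul a b ;
  cmulZr : forall (z : R[i]) a b, cmul a (z *: b) = z *: cmul a b ;
  cstarK : forall a, cstar (cstar a) = a ;
  cstarD : forall a b, cstar (a + b) = cstar a + cstar b ;
  cstarZ : forall (z : R[i]) a, cstar (z *: a) = (z^*)%R *: cstar a ;
  cstarM : forall a b, cstar (cmul a b) = cmul (cstar b) (cstar a) ;
  cnormM : forall a b, `|cmul a b| <= `|a| * `|b| ;
  cnorm_star : forall a, `|cmul (cstar a) a| = `|a| ^+ 2
}.

#[short(type="cstarType")]
HB.structure Definition CStarAlgebra (R : realType) :=
  {A of isCStarAlgebra R A & CompleteNormedModule R[i] A}.

Definition cpos (R : realType) (A : cstarType R) (a : A) : Prop :=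
  exists b : A, a = cmul (cstar b) b.

(* Right A-modules with a nondegenerate Hermitian A-valued form, linear in the
   second variable. This is the part of the Hilbert module structure used to
   define adjoints, norms and closed ranges; it passes to direct sums by purely
   algebraic means. Positivity, definiteness and completeness are added below. *)
HB.mixin Record isInnerModule (R : realType) (A : cstarType R) (H : Type)
    of GRing.Lmodule R[i] H := {
  act : H -> A -> H ;
  inner : H -> H -> A ;
  actDl : forall x y a, act (x + y) a = act x a + act y a ;
  actDr : forall x a b, act x (a + b) = act x a + act x b ;
  actM : forall x a b, act x (cmul a b) = act (act x a) b ;
  actZl : forall (z : R[i]) x a, act (z *: x) a = z *: act x a ;
  actZr : forall (z : R[i]) x a, act x (z *: a) = z *: act x a ;
  innerDr : forall x y y', inner x (y + y') = inner x y + inner x y' ;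
  innerZr : forall (z : R[i]) x y, inner x (z *: y) = z *: inner x y ;
  inner_act : forall x y a, inner x (act y a) = cmul (inner x y) a ;
  inner_star : forall x y, inner y x = cstar (inner x y) ;
  inner_nondeg : forall x, (forall y, inner x y = 0) -> x = 0
}.

#[short(type="innerModType")]
HB.structure Definition InnerModule (R : realType) (A : cstarType R) :=
  {H of isInnerModule R A H & GRing.Lmodule R[i] H}.

Definition hnorm (R : realType) (A : cstarType R) (H : innerModType A) (x : H)
  : R[i] := sqrtC `|inner x x : A|.

HB.mixin Record isHilbertModule (R : realType) (A : cstarType R) (H : Type)
    of InnerModule R A H := {
  inner_ge0 : forall x : H, cpos (inner x x : A) ;
  inner_eq0 : forall x : H, (inner x x : A) = 0 -> x = 0 ;
  hcomplete : forall u : nat -> H,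
    (forall e : R[i], 0 < e -> exists N, forall m n, (N <= m)%N -> (N <= n)%N ->
       hnorm (u m - u n) < e) ->
    exists l : H, forall e : R[i], 0 < e -> exists N, forall n, (N <= n)%N ->
       hnorm (u n - l) < e
}.

#[short(type="hilbertModType")]
HB.structure Definition HilbertModule (R : realType) (A : cstarType R) :=
  {H of isHilbertModule R A H & InnerModule R A H}.

Section InnerTheory.
Context (R : realType) (A : cstarType R).

Lemma cstar0 : cstar (0 : A) = 0.
Proof. by apply: (addrI (cstar 0)); rewrite -cstarD !addr0. Qed.

Lemma cstarN (a : A) : cstar (- a) = - cstar a.
Proof. by apply/eqP; rewrite -addr_eq0 -cstarD addNr cstar0. Qed.

Context (H : innerModType A).
Implicit Types x y : H.

Lemma innerDl x x' y : inner (x + x') y = inner x y + inner x' y :> A.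
Proof. by rewrite inner_star innerDr cstarD -!inner_star. Qed.

Lemma inner0r x : inner x (0 : H) = 0 :> A.
Proof. by apply: (addrI (inner x 0)); rewrite -innerDr !addr0. Qed.

Lemma inner0l x : inner (0 : H) x = 0 :> A.
Proof. by rewrite inner_star inner0r cstar0. Qed.

Lemma innerNr x y : inner x (- y) = - inner x y :> A.
Proof. by apply/eqP; rewrite -addr_eq0 -innerDr addNr inner0r. Qed.

Lemma innerNl x y : inner (- x) y = - inner x y :> A.
Proof. by rewrite inner_star innerNr cstarN -inner_star. Qed.

Lemma inner_injl x x' : (forall y, inner x y = inner x' y :> A) -> x = x'.
Proof.
move=> h; apply/eqP; rewrite -subr_eq0; apply/eqP; apply: inner_nondeg => y.
by rewrite innerDl innerNl h subrr.
Qed.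

End InnerTheory.

Section DirectSum.
Context (R : realType) (A : cstarType R) (H1 H2 : innerModType A).
Implicit Types x y : (H1 * H2)%type.

Let dact x (a : A) : (H1 * H2)%type := (act x.1 a, act x.2 a).
Let dinner x y : A := inner x.1 y.1 + inner x.2 y.2.

Let dactDl x y a : dact (x + y) a = dact x a + dact y a.
Proof. by rewrite /dact /= !actDl. Qed.
Let dactDr x a b : dact x (a + b) = dact x a + dact x b.
Proof. by rewrite /dact !actDr. Qed.
Let dactM x a b : dact x (cmul a b) = dact (dact x a) b.
Proof. by rewrite /dact !actM. Qed.
Let dactZl (z : R[i]) x a : dact (z *: x) a = z *: dact x a.
Proof. by rewrite /dact /= !actZl. Qed.
Let dactZr (z : R[i]) x a : dact x (z *: a) = z *: dact x a.
Proof. by rewrite /dact !actZr. Qed.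
Let dinnerDr x y y' : dinner x (y + y') = dinner x y + dinner x y'.
Proof. by rewrite /dinner /= !innerDr addrACA. Qed.
Let dinnerZr (z : R[i]) x y : dinner x (z *: y) = z *: dinner x y.
Proof. by rewrite /dinner /= !innerZr scalerDr. Qed.
Let dinner_act x y a : dinner x (dact y a) = cmul (dinner x y) a.
Proof. by rewrite /dinner /= !inner_act cmulDl. Qed.
Let dinner_star x y : dinner y x = cstar (dinner x y).
Proof. by rewrite /dinner cstarD -!inner_star. Qed.
Let dinner_nondeg x : (forall y, dinner x y = 0) -> x = 0.
Proof.
case: x => x1 x2 h; congr pair; apply: inner_nondeg => y.
- by have := h (y, 0); rewrite /dinner /= inner0r addr0.
- by have := h (0, y); rewrite /dinner /= inner0r add0r.
Qed.

HB.instance Definition _ := isInnerModule.Build R A (H1 * H2)%type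
  dactDl dactDr dactM dactZl dactZr dinnerDr dinnerZr dinner_act dinner_star
  dinner_nondeg.

End DirectSum.

(* L(H, K). The adjoint is carried along; by [adjointable_eq] it is determined
   by the operator, and linearity and boundedness are consequences of [opP]. *)
Record adjointable (R : realType) (A : cstarType R) (H K : innerModType A) :=
  Adjointable {
    op :> H -> K ;
    opadj : K -> H ;
    opP : forall x y, inner (op x) y = inner x (opadj y) :> A
  }.

Section Adjointable.
Context (R : realType) (A : cstarType R).
Implicit Types H K L : innerModType A.

Lemma adjointable_eq H K (S T : adjointable H K) : S =1 T -> S = T.
Proof.
case: S T => [s s' sP] [t t' tP] /= /funext est; subst t.
have e : s' = t'.
  apply/funext => y; apply: inner_injl => x.
  by rewrite inner_star -sP tP -inner_star.
by subst t'; congr Adjointable; exact: Prop_irrelevance.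
Qed.

HB.instance Definition _ H K := gen_eqMixin (adjointable H K).
HB.instance Definition _ H K := gen_choiceMixin (adjointable H K).

Definition adj H K (T : adjointable H K) : adjointable K H.
Proof.
exists (opadj T) (op T) => x y.
by rewrite inner_star -opP -inner_star.
Defined.

Definition opid H : adjointable H H.
Proof. by exists id id. Defined.

Definition opcomp H K L (S : adjointable K L) (T : adjointable H K)
  : adjointable H L.
Proof. by exists (S \o T) (opadj T \o opadj S) => x y /=; rewrite !opP. Defined.

Definition opzero H K : adjointable H K.
Proof.
by exists (fun=> 0) (fun=> 0) => x y; rewrite inner0l inner0r.
Defined.

Definition opadd H K (S T : adjointable H K) : adjointable H K.
Proof.
exists (fun x => S x + T x) (fun y => opadj S y + opadj T y) => x y.
by rewrite innerDl innerDr !opP.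
Defined.

Definition opopp H K (T : adjointable H K) : adjointable H K.
Proof.
exists (fun x => - T x) (fun y => - opadj T y) => x y.
by rewrite innerNl innerNr opP.
Defined.

Let opaddA H K : associative (@opadd H K).
Proof. by move=> S T U; apply: adjointable_eq => x /=; rewrite addrA. Qed.
Let opaddC H K : commutative (@opadd H K).
Proof. by move=> S T; apply: adjointable_eq => x /=; rewrite addrC. Qed.
Let opadd0 H K : left_id (opzero H K) (@opadd H K).
Proof. by move=> T; apply: adjointable_eq => x /=; rewrite add0r. Qed.
Let opaddN H K : left_inverse (opzero H K) (@opopp H K) (@opadd H K).
Proof. by move=> T; apply: adjointable_eq => x /=; rewrite addNr. Qed.

HB.instance Definition _ H K := GRing.isZmodule.Build (adjointable H K)
  (@opaddA H K) (@opaddC H K) (@opadd0 H K) (@opaddN H K).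

End Adjointable.

Declare Scope hilbert_scope.
Delimit Scope hilbert_scope with H.
Notation "''L' ( H , K )" := (adjointable H K)
  (at level 8, format "''L' ( H ,  K )") : type_scope.
Notation "''L' ( H )" := (adjointable H H)
  (at level 8, format "''L' ( H )") : type_scope.
Notation "S *o T" := (opcomp S T)
  (at level 40, left associativity) : hilbert_scope.
Notation "T ^*" := (adj T) : hilbert_scope.

Local Open Scope hilbert_scope.

Section Blocks.
Context (R : realType) (A : cstarType R).
Implicit Types H K : innerModType A.

Definition row_op H1 H2 K (T1 : 'L(H1, K)) (T2 : 'L(H2, K))
  : 'L((H1 * H2)%type, K).
Proof.
exists (fun h => T1 h.1 + T2 h.2) (fun k => (opadj T1 k, opadj T2 k)) => x y.
by rewrite innerDl !opP.
Defined.

Definition col_op H K1 K2 (T1 : 'L(H, K1)) (T2 : 'L(H, K2))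
  : 'L(H, (K1 * K2)%type).
Proof.
exists (fun h => (T1 h, T2 h)) (fun k => opadj T1 k.1 + opadj T2 k.2) => x y.
by rewrite innerDr -!opP.
Defined.

Definition block_op H1 H2 K1 K2 (T11 : 'L(H1, K1)) (T12 : 'L(H2, K1))
    (T21 : 'L(H1, K2)) (T22 : 'L(H2, K2))
  : 'L((H1 * H2)%type, (K1 * K2)%type) :=
  col_op (row_op T11 T12) (row_op T21 T22).

Definition diag_op H1 H2 K1 K2 (T1 : 'L(H1, K1)) (T2 : 'L(H2, K2))
  : 'L((H1 * H2)%type, (K1 * K2)%type) := block_op T1 0 0 T2.

(* Blocks of an operator between direct sums; see [block_opK]. *)
Definition fst_op H1 H2 : 'L((H1 * H2)%type, H1) := row_op (opid H1) 0.
Definition snd_op H1 H2 : 'L((H1 * H2)%type, H2) := row_op 0 (opid H2).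

Section BlockOf.
Context (H1 H2 K1 K2 : innerModType A).
Variable T : 'L((H1 * H2)%type, (K1 * K2)%type).
Definition ul_op : 'L(H1, K1) := fst_op K1 K2 *o T *o (fst_op H1 H2)^*.
Definition ur_op : 'L(H2, K1) := fst_op K1 K2 *o T *o (snd_op H1 H2)^*.
Definition dl_op : 'L(H1, K2) := snd_op K1 K2 *o T *o (fst_op H1 H2)^*.
Definition dr_op : 'L(H2, K2) := snd_op K1 K2 *o T *o (snd_op H1 H2)^*.
End BlockOf.

Lemma opD H K (T : 'L(H, K)) x y : T (x + y) = T x + T y.
Proof.
by apply: inner_injl => z; rewrite innerDl !opP innerDl.
Qed.

Lemma block_opK H1 H2 K1 K2 (T : 'L((H1 * H2)%type, (K1 * K2)%type)) :
  block_op (ul_op T) (ur_op T) (dl_op T) (dr_op T) = T.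
Proof.
apply: adjointable_eq => -[h1 h2] /=.
have -> : T (h1, h2) = T (h1, 0) + T (0, h2).
  by rewrite -opD; congr (T _); congr pair; rewrite ?addr0 ?add0r.
case: (T (h1, 0)) (T (0, h2)) => a b [c d] /=.
by congr pair; rewrite /= ?addr0 ?add0r.
Qed.

End Blocks.

Section MoorePenrose.
Context (R : realType) (A : cstarType R).
Implicit Types H K : innerModType A.

Definition closed_range H K (T : 'L(H, K)) : Prop :=
  forall y : K, (forall e : R[i], 0 < e -> exists x, hnorm (T x - y) < e) ->
  exists x, T x = y.

Definition is_opinv K (M N : 'L(K)) : Prop :=
  M *o N = opid K /\ N *o M = opid K.

Definition opinv K (M : 'L(K)) : 'L(K) := xget 0 [set N | is_opinv M N]%classic.

Definition positive_definite K (M : 'L(K)) : Prop :=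
  (forall x, cpos (inner (M x) x : A)) /\ exists N, is_opinv M N.

Definition is_wmpinv H K (M : 'L(K)) (N : 'L(H)) (T : 'L(H, K)) (X : 'L(K, H))
  : Prop :=
  [/\ T *o X *o T = T, X *o T *o X = X, (M *o T *o X)^* = M *o T *o X
    & (N *o X *o T)^* = N *o X *o T].

(* The weighted Moore-Penrose inverse, with junk value 0 when the weights are
   not positive definite or no such inverse exists. *)
Definition wmpinv H K (M : 'L(K)) (N : 'L(H)) (T : 'L(H, K)) : 'L(K, H) :=
  xget 0 [set X | [/\ positive_definite M, positive_definite N
                    & is_wmpinv M N T X]]%classic.

Definition mpinv H K (T : 'L(H, K)) : 'L(K, H) := wmpinv (opid K) (opid H) T.

End MoorePenrose.

Section Schur.
Context (R : realType) (A : cstarType R) (K1 K2 : innerModType A).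
Variable E : 'L((K1 * K2)%type).

Definition schur : 'L(K2) :=
  dr_op E - (ur_op E)^* *o mpinv (ul_op E) *o ur_op E.

Definition F1 : 'L(K2, (K1 * K2)%type) :=
  col_op (- (mpinv (ul_op E) *o ur_op E)) (opid K2).

Definition schur_g : 'L(K2) :=
  wmpinv (opinv (F1^* *o F1)) (F1^* *o F1) schur.

Definition XR : 'L((K1 * K2)%type) :=
  opid _ - mpinv (F1^*) *o (opid K2 - schur *o schur_g) *o F1^*.

End Schur.

(* Main.v *)
Require Import Defs.
From HB Require Import structures.
From mathcomp Require Import all_boot all_order all_algebra complex.
From mathcomp Require Import all_classical all_reals all_analysis.
From mathcomp Require Import ring.

Set Implicit Arguments.
Unset Strict Implicit.
Unset Printing Implicit Defensive.

Import Order.TTheory GRing.Theory Num.Theory numFieldNormedType.Exports.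

Local Open Scope ring_scope.
Local Open Scope hilbert_scope.

(** Write [E = T T^*], [D] for the Moore-Penrose inverse of [E11], [F] for
    [F1 E], [S] for the Schur complement, [X] for its weighted inverse, and
    [T^* Z] for the right-hand side. The four Penrose equations for [T] and
    [T^* Z] can be checked directly ([penrose_formula]). The range of [E12] lies
    in that of [E11], so that [E F = e2 S], where [e2] is the inclusion of the
    second summand; moreover [F^* e2 = 1]. Hence
      [E Z = 1 - diag (1 - E11 D, 0) - F (F^* F)^-1 (1 - S X) F^*].
    This is self-adjoint because of the weight condition on [S X]. It fixes [T]
    because [(1 - S X) S = 0] and [S = (T^* F)^* (T^* F)].

    The analysis lies in the existence of [D], [X] and [(F^* F)^-1], and in the
    positivity of the weights. If an operator [V] has closed range, uniform
    boundedness shows that [V^*] is bounded below on the range of [V]. So [V V^*]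
    is a positive operator that is bounded below on this range, and such an
    operator is onto ([pos_below_onto]): adding a large scalar makes it onto, and
    the scalar can be removed in steps of fixed size. Inverting [V V^*] on the
    range of [V] gives the Moore-Penrose inverse ([closed_range_mpinv]). The same
    theorem makes [1 + C^* C] invertible. It applies to [F^* F = 1 + B^* B] with
    [B = D E12], and to the compression of [F^* F] to the kernel of [S], which
    turns the Moore-Penrose inverse of [S] into the weighted one
    ([weighted_mpinv]).

    Norms on Hilbert modules and positivity of direct sums depend on the fact
    that the elements [b^* b] of a C*-algebra form a convex cone on which the
    norm is monotone. Positivity is therefore first expressed by norms in the
    unitization ([spos]), where sums are harmless, and then identified with
    being of the form [b^* b] ([spos_cstar_mul], [cposP]). The tools are square
    roots ([visser]) and the bound of the real part of a normal element by its
    modulus ([bnd_normal_part]). *)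

(** * Completeness in epsilon form *)

Section Sequences.
Local Open Scope classical_set_scope.

Definition eps_cauchy (K : numDomainType) (T : Type) (d : T -> T -> K)
    (u : nat -> T) : Prop :=
  forall e : K, 0 < e ->
    exists N, forall m n, (N <= m)%N -> (N <= n)%N -> d (u m) (u n) < e.

Definition eps_cvg (K : numDomainType) (T : Type) (d : T -> T -> K)
    (u : nat -> T) (l : T) : Prop :=
  forall e : K, 0 < e -> exists N, forall n, (N <= n)%N -> d (u n) l < e.

Definition ndist (K : numDomainType) (V : normedZmodType K) (x y : V) : K :=
  `|x - y|.

Lemma normed_complete (K : numFieldType) (V : completeNormedModType K)
    (u : nat -> V) :
  eps_cauchy (@ndist K V) u -> exists l, eps_cvg (@ndist K V) u l.
Proof.
move=> hu.
have /cauchy_cvgP/cvg_ex[l] : cauchy (u @ \oo).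
  apply: cauchy_exP => e e0.
  have [N hN] := hu e e0; exists (u N); exists N => // n /= Nn.
  by rewrite -ball_normE /=; apply: hN.
move=> /cvgrPdist_lt hl; exists l => e e0.
have [N _ hN] := hl e e0; exists N => n Nn.
by rewrite /ndist distrC; apply: hN.
Qed.

Context (R : realType).
Implicit Types (e : R[i]) (m n N : nat).

(** The rate [2 / (n + 2)] is the one obtained for the iteration that computes
    square roots. *)
Lemma complex_archi e : 0 < e -> exists N, forall n, (N <= n)%N ->
  (2 : R[i]) / n.+2%:R < e.
Proof.
rewrite ltcE /= => /andP[/eqP ei er]; case: e ei er => r j /= -> r0.
have rr : 0 < 2 / r by rewrite divr_gt0.
exists (Num.bound (2 / r)) => n nN.
have -> : (2 : R[i]) / n.+2%:R = (2 / n.+2%:R)%:C%C.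
  by rewrite rmorphM fmorphV /= !rmorph_nat.
rewrite ltcR ltr_pdivrMr ?ltr0n // mulrC -ltr_pdivrMr //.
have := archi_boundP (ltW rr); move/lt_trans; apply.
by rewrite ltr_nat ltnS (leq_trans nN).
Qed.

Lemma normC_le_ReIm (z : R[i]) :
  `|z| <= `|complex.Re z|%:C%C + `|complex.Im z|%:C%C.
Proof.
case: z => a b; rewrite normc_def /= -rmorphD lecR /=.
rewrite -(ler_pXn2r (n := 2)) ?nnegrE ?sqrtr_ge0 ?addr_ge0 //.
rewrite sqr_sqrtr ?addr_ge0 ?sqr_ge0 // sqrrD !real_normK ?num_real //.
by rewrite lerD2r lerDl mulrn_wge0 // mulr_ge0.
Qed.

Lemma normC_ge_Im (z : R[i]) : `|complex.Im z|%:C%C <= `|z|.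
Proof.
have ni : `|'i%C : R[i]| = 1.
  by rewrite normc_def /= expr0n add0r expr1n sqrtr1.
by have := normc_ge_Re (z * 'i%C); rewrite ReiNIm normrN normrM ni mulr1.
Qed.

Lemma complex_complete (u : nat -> R[i]) :
  eps_cauchy (@ndist _ _) u -> exists l, eps_cvg (@ndist _ _) u l.
Proof.
move=> hu.
have hp (p : R[i] -> R) : {morph p : x y / x - y} ->
    (forall z, `|p z|%:C%C <= `|z|) ->
    exists l, eps_cvg (@ndist R R) (p \o u) l.
  move=> pB p_le; apply: (@normed_complete R R) => e e0.
  have [|N hN] := hu e%:C%C; first by rewrite ltcR.
  exists N => m n Nm Nn; rewrite /ndist /= -pB -ltcR.
  exact: le_lt_trans (p_le _) (hN m n Nm Nn).
have [|a ha] := hp (@complex.Re R) _ (@normc_ge_Re R).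
  by move=> [? ?] [? ?].
have [|b hb] := hp (@complex.Im R) _ normC_ge_Im.
  by move=> [? ?] [? ?].
exists (a +i* b)%C => e; rewrite ltcE /= => /andP[/eqP ei er].
have e2 : 0 < complex.Re e / 2 by rewrite divr_gt0.
have [N hN] := ha _ e2; have [M hM] := hb _ e2.
exists (maxn N M) => n; rewrite geq_max => /andP[/hN aN /hM bM].
apply: le_lt_trans (normC_le_ReIm _) _.
rewrite ltcE /= addr0 ei eqxx /= [ltRHS]splitr ltrD //.
  by move: aN; rewrite /ndist /=; case: (u n).
by move: bM; rewrite /ndist /=; case: (u n).
Qed.

End Sequences.
(** * The unitization of a C*-algebra *)

Section CStarBasics.
Context (R : realType) (A : cstarType R).
Implicit Types a b : A.

Lemma cmul0l a : cmul 0 a = 0.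
Proof. by apply: (addrI (cmul 0 a)); rewrite -cmulDl !addr0. Qed.

Lemma cmul0r a : cmul a 0 = 0.
Proof. by apply: (addrI (cmul a 0)); rewrite -cmulDr !addr0. Qed.

Lemma cstar_norm a : `|cstar a| = `|a|.
Proof.
have h b : `|b| <= `|cstar b|.
  have [->|b0] := eqVneq b 0; first by rewrite cstar0.
  have := cnormM (cstar b) b.
  by rewrite cnorm_star expr2 ler_pM2r // normr_gt0.
by apply/eqP; rewrite eq_le h -{2}(cstarK a) h.
Qed.

End CStarBasics.

(** Pairs (z, a) standing for z 1 + a. The unit is adjoined even when the
    algebra already has one, so that positivity has a single definition. *)
Definition unitz (R : realType) (A : cstarType R) : Type := (R[i] * A)%type.

Section Unitization.
Context (R : realType) (A : cstarType R).
Local Notation U := (unitz A).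
Implicit Types u v w : U.

HB.instance Definition _ := GRing.Zmodule.copy U (R[i] * A)%type.

Definition umul u v : U :=
  (u.1 * v.1, u.1 *: v.2 + v.1 *: u.2 + cmul u.2 v.2).
Definition uone : U := (1, 0).
Definition uscale (z : R[i]) u : U := (z * u.1, z *: u.2).
Definition ustar u : U := (Num.conj u.1, cstar u.2).
Definition uemb (a : A) : U := (0, a).

Let umulA : associative umul.
Proof.
move=> [x a] [y b] [z c]; congr pair; rewrite /= ?mulrA //.
rewrite !scalerDr !cmulDl !cmulDr !cmulZl !cmulZr !scalerA cmulA.
rewrite -!addrA [z * x]mulrC [z * y]mulrC; congr (_ + (_ + _)).
by rewrite [LHS]addrCA; congr (_ + _); rewrite [RHS]addrCA; congr (_ + _);
   rewrite addrCA.
Qed.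

Let umul1 : left_id uone umul.
Proof.
by case=> x a; rewrite /umul /= mul1r scale1r scaler0 cmul0l !addr0.
Qed.

Let umulr1 : right_id uone umul.
Proof.
by case=> x a; rewrite /umul /= mulr1 scale1r scaler0 cmul0r add0r addr0.
Qed.

Let umulDl : left_distributive umul +%R.
Proof.
move=> [x a] [y b] [z c]; congr pair; rewrite /= ?mulrDl //.
by rewrite scalerDl scalerDr cmulDl [X in X + _]addrACA [LHS]addrACA.
Qed.

Let umulDr : right_distributive umul +%R.
Proof.
move=> [x a] [y b] [z c]; congr pair; rewrite /= ?mulrDr //.
by rewrite scalerDl scalerDr cmulDr [X in X + _]addrACA [LHS]addrACA.
Qed.

Let uone_neq0 : uone != 0.
Proof. by apply/eqP => -[] /eqP; rewrite oner_eq0. Qed.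

HB.instance Definition _ := GRing.Zmodule_isNzRing.Build U
  umulA umul1 umulr1 umulDl umulDr uone_neq0.

Let uscaleA (z t : R[i]) u : uscale z (uscale t u) = uscale (z * t) u.
Proof. by rewrite /uscale /= mulrA scalerA. Qed.
Let uscale1 : left_id 1 uscale.
Proof. by case=> x a; rewrite /uscale mul1r scale1r. Qed.
Let uscaleDr : right_distributive uscale +%R.
Proof. by move=> z u v; rewrite /uscale /= mulrDr scalerDr. Qed.
Let uscaleDl u : {morph uscale^~ u : a b / a + b}.
Proof. by move=> a b; rewrite /uscale mulrDl scalerDl. Qed.

HB.instance Definition _ := GRing.Zmodule_isLmodule.Build R[i] U
  uscaleA uscale1 uscaleDr uscaleDl.

Let uscaleAl (z : R[i]) u v : z *: (u * v) = z *: u * v.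
Proof.
congr pair; rewrite /= ?mulrA //.
by rewrite !scalerDr cmulZl !scalerA [v.1 * z]mulrC.
Qed.

HB.instance Definition _ := GRing.Lmodule_isLalgebra.Build R[i] U uscaleAl.

Let uscaleAr (z : R[i]) u v : z *: (u * v) = u * (z *: v).
Proof.
congr pair; rewrite /=; first by rewrite mulrCA.
by rewrite !scalerDr cmulZr !scalerA [z * u.1]mulrC.
Qed.

HB.instance Definition _ := GRing.Lalgebra_isAlgebra.Build R[i] U uscaleAr.

Lemma ustarK : involutive ustar.
Proof. by case=> x a; rewrite /ustar /= conjCK cstarK. Qed.

Lemma ustarD u v : ustar (u + v) = ustar u + ustar v.
Proof. by rewrite /ustar rmorphD cstarD. Qed.

Lemma ustarM u v : ustar (u * v) = ustar v * ustar u.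
Proof.
case: u v => [x a] [y b]; congr pair; rewrite /=.
  by rewrite rmorphM /= mulrC.
by rewrite !cstarD !cstarZ cstarM [X in X + _ = _]addrC.
Qed.

Lemma ustarZ (z : R[i]) u : ustar (z *: u) = Num.conj z *: ustar u.
Proof.
case: u => x a; congr pair; rewrite /= ?cstarZ //.
by rewrite rmorphM.
Qed.

Lemma ustar1 : ustar 1 = 1.
Proof. by congr pair; rewrite /= ?rmorph1 ?cstar0. Qed.

Lemma ustar0 : ustar 0 = 0.
Proof. by congr pair; rewrite /= ?rmorph0 ?cstar0. Qed.

Lemma ustarN u : ustar (- u) = - ustar u.
Proof. by rewrite -scaleN1r ustarZ rmorphN1 scaleN1r. Qed.

Lemma ustarB u v : ustar (u - v) = ustar u - ustar v.
Proof. by rewrite ustarD ustarN. Qed.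

Definition uapp u (x : A) : A := u.1 *: x + cmul u.2 x.

Lemma uappD u v x : uapp (u + v) x = uapp u x + uapp v x.
Proof. by rewrite /uapp /= scalerDl cmulDl addrACA. Qed.

Lemma uappM u v x : uapp (u * v) x = uapp u (uapp v x).
Proof.
rewrite /uapp /= !cmulDl !cmulZl !scalerDr !cmulDr !cmulZr !scalerA cmulA.
by rewrite -!addrA.
Qed.

Lemma uappZ (z : R[i]) u x : uapp (z *: u) x = z *: uapp u x.
Proof. by rewrite /uapp /= cmulZl scalerDr scalerA. Qed.

Lemma uapp_adj u x y :
  cmul (cstar (uapp u x)) y = cmul (cstar x) (uapp (ustar u) y).
Proof.
by rewrite /uapp cstarD cstarZ cstarM cmulDl cmulZl cmulDr cmulZr cmulA.
Qed.

(** The statement that the C*-norm of [u] is at most [c]. The norm is the larger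
    of the modulus of the scalar part and the norm of u as a multiplier; the
    former matters only if the algebra already has a unit. *)
Definition bnd u (c : R[i]) : Prop :=
  `|u.1| <= c /\ forall x, `|uapp u x| <= c * `|x|.

Lemma bnd_ge0 u c : bnd u c -> 0 <= c.
Proof. by case=> h _; exact: le_trans h. Qed.

Lemma bndW u c d : c <= d -> bnd u c -> bnd u d.
Proof.
move=> cd [h1 h2]; split=> [|x]; first exact: le_trans cd.
by apply: le_trans (h2 x) _; rewrite ler_wpM2r.
Qed.

Lemma bndD u v c d : bnd u c -> bnd v d -> bnd (u + v) (c + d).
Proof.
move=> [u1 u2] [v1 v2]; split=> [|x].
  by apply: le_trans (ler_normD _ _) _; exact: lerD.
by rewrite uappD mulrDl; apply: le_trans (ler_normD _ _) _; exact: lerD.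
Qed.

Lemma bndM u v c d : bnd u c -> bnd v d -> bnd (u * v) (c * d).
Proof.
move=> hu hv; have c0 := bnd_ge0 hu; case: hu hv => [u1 u2] [v1 v2].
split=> [|x]; first by rewrite normrM ler_pM.
rewrite uappM -mulrA; apply: le_trans (u2 _) _.
by rewrite ler_wpM2l.
Qed.

Lemma bndZ (z : R[i]) u c : bnd u c -> bnd (z *: u) (`|z| * c).
Proof.
move=> [u1 u2]; split=> [|x]; first by rewrite normrM ler_wpM2l.
by rewrite uappZ normrZ -mulrA ler_wpM2l.
Qed.

Lemma bndN u c : bnd u c -> bnd (- u) c.
Proof. by move/(bndZ (-1)); rewrite normrN1 mul1r scaleN1r. Qed.

Lemma bndB u v c d : bnd u c -> bnd v d -> bnd (u - v) (c + d).
Proof. by move=> hu /bndN; exact: bndD. Qed.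

Lemma bnd0 : bnd 0 0.
Proof.
split=> [|x]; first by rewrite normr0.
by rewrite /uapp scale0r cmul0l addr0 normr0 mul0r.
Qed.

Lemma bnd1 : bnd 1 1.
Proof.
split=> [|x]; first by rewrite normr1.
by rewrite /uapp scale1r cmul0l addr0 mul1r.
Qed.

Lemma bnd_cst (c : R[i]) : 0 <= c -> bnd (c *: 1) c.
Proof.
by move=> c0; have := bndZ c bnd1; rewrite mulr1 ger0_norm.
Qed.

Lemma bnd_star u c : bnd u c -> bnd (ustar u) c.
Proof.
move=> [u1 u2]; split=> [|x]; first by rewrite norm_conjC.
set y := uapp _ x.
have [->|y0] := eqVneq y 0.
  by rewrite normr0 mulr_ge0 // (le_trans _ u1).
have : `|y| ^+ 2 <= c * `|x| * `|y|.
  rewrite -cnorm_star {1}/y uapp_adj ustarK.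
  apply: le_trans (cnormM _ _) _; rewrite cstar_norm.
  by rewrite mulrC mulrAC ler_wpM2r.
by rewrite expr2 ler_pM2r // normr_gt0.
Qed.

(** The nontrivial half of the C*-identity [|u^* u| = |u|^2]. *)
Lemma bnd_cstar u c : 0 <= c -> bnd (ustar u * u) (c ^+ 2) -> bnd u c.
Proof.
move=> c0 [u1 u2]; split=> [|x].
  rewrite -(ler_pXn2r (n := 2)) ?nnegrE //.
  by apply: le_trans u1; rewrite /= normrM norm_conjC expr2.
rewrite -(ler_pXn2r (n := 2)) ?nnegrE // ?mulr_ge0 //.
rewrite -cnorm_star uapp_adj -uappM exprMn.
apply: le_trans (cnormM _ _) _; rewrite cstar_norm.
by rewrite [X in _ <= _ * X]expr2 mulrCA ler_wpM2l.
Qed.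

Lemma bnd_emb (a : A) c : bnd (uemb a) c <-> `|a| <= c.
Proof.
split=> [[c0 h]|h].
  have [->|a0] := eqVneq a 0; first by move: c0; rewrite !normr0.
  have := h (cstar a); rewrite /uapp scale0r add0r -{1}[a]cstarK cnorm_star.
  by rewrite expr2 ler_pM2r cstar_norm ?normr_gt0.
split=> [|x]; first by rewrite normr0; exact: le_trans h.
rewrite /uapp scale0r add0r; apply: le_trans (cnormM _ _) _.
by rewrite ler_wpM2r.
Qed.

Lemma bnd_snd u c : bnd u c -> `|u.2| <= 2 * c.
Proof.
move=> hu; apply/bnd_emb.
have -> : uemb u.2 = u - u.1 *: 1.
  congr pair; rewrite /= ?mulr1 ?subrr //.
  by rewrite scaler0 subr0.
rewrite mulr_natl mulr2n; apply: bndB => //.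
have := bndZ u.1 bnd1; rewrite mulr1; apply: bndW.
by case: hu.
Qed.

Lemma bnd_eq0 u : (forall e, 0 < e -> bnd u e) -> u = 0.
Proof.
move=> h; have h0 (K : numFieldType) (V : normedZmodType K) (x : V) k : 0 <= k ->
    (forall e, 0 < e -> `|x| <= k * e) -> x = 0.
  move=> k0 hx; apply/eqP; rewrite -normr_le0; apply/ler_addgt0Pr => e e0.
  rewrite add0r; have k1 : 0 < k + 1 by rewrite ltr_wpDl.
  apply: le_trans (hx (e / (k + 1)) _) _; first by rewrite divr_gt0.
  by rewrite mulrCA ler_piMr ?(ltW e0) // ler_pdivrMr // mul1r lerDl.
case: u h => z a h; congr pair.
  apply: (h0 _ _ _ 1) => // e e0; rewrite mul1r; exact: (h e e0).1.
by apply: (h0 _ _ _ 2) => // e e0; exact: (bnd_snd (h e e0)).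
Qed.

Lemma bnd_eq00 u : bnd u 0 -> u = 0.
Proof. by move=> h; apply: bnd_eq0 => e /ltW e0; exact: bndW h. Qed.

Lemma unitz_complete (u : nat -> U) (d : nat -> R[i]) :
  (forall m n, (m <= n)%N -> bnd (u n - u m) (d m)) ->
  (forall e, 0 < e -> exists N, forall n, (N <= n)%N -> d n < e) ->
  exists l, forall e, 0 < e -> exists N, forall n, (N <= n)%N -> bnd (u n - l) e.
Proof.
move=> hu hd.
have cauchy (V : normedZmodType R[i]) (p : nat -> V) :
    (forall m n, (m <= n)%N -> `|p n - p m| <= 2 * d m) ->
    eps_cauchy (@ndist _ V) p.
  move=> hp e e0; have [|N hN] := hd (e / 4); first by rewrite divr_gt0.
  have near n : (N <= n)%N -> `|p n - p N| < e / 2.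
    move=> Nn; apply: le_lt_trans (hp _ _ Nn) _.
    rewrite -ltr_pdivlMl // mulrC -mulrA -invfM -natrM; exact: hN.
  exists N => m n Nm Nn; rewrite /ndist [ltRHS]splitr.
  have -> : p m - p n = (p m - p N) - (p n - p N) by rewrite opprB addrA subrK.
  by apply: le_lt_trans (ler_normB _ _) _; rewrite ltrD ?near.
have [|z hz] := complex_complete (cauchy _ (fst \o u) _).
  move=> m n mn; have h := hu m n mn; case: (h) => h1 _.
  by apply: le_trans h1 _; rewrite ler_peMl ?(bnd_ge0 h) // ler1n.
have [|a ha] := normed_complete (cauchy A (snd \o u) _).
  by move=> m n mn; exact: (bnd_snd (hu m n mn)).
exists (z, a) => e e0; have e2 : 0 < e / 2 by rewrite divr_gt0.
have [N hN] := hz _ e2; have [M hM] := ha _ e2.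
exists (maxn N M) => n; rewrite geq_max => /andP[/hN zn /hM an].
have -> : u n - (z, a) = ((u n).1 - z) *: 1 + uemb ((u n).2 - a).
  congr pair; rewrite /= ?mulr1 ?addr0 //.
  by rewrite scaler0 add0r.
rewrite [X in bnd _ X]splitr; apply: bndD.
  have := bndZ ((u n).1 - z) bnd1; rewrite mulr1; apply: bndW; exact: ltW zn.
by apply/bnd_emb; exact: ltW an.
Qed.

End Unitization.
(** * Positive elements of the unitization *)

Section Positivity.
Context (R : realType) (A : cstarType R).
Local Notation U := (unitz A).
Implicit Types (u v k h s : U) (c e : R[i]).

Lemma bnd_ex u : exists2 c, 0 < c & bnd u c.
Proof.
exists (`|u.1| + `|u.2| + 1); first by rewrite ltr_wpDl ?addr_ge0.
have -> : u = u.1 *: 1 + uemb u.2.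
  by case: u => z a; congr pair; rewrite /= ?mulr1 ?addr0 // scaler0 add0r.
apply: (@bndW _ _ _ (`|u.1| + `|u.2|)).
  by rewrite /= mulr1 addr0 scaler0 add0r lerDl.
apply: bndD; last by apply/bnd_emb.
by have := bndZ u.1 (@bnd1 _ A); rewrite mulr1.
Qed.

Lemma bnd_small_eq0 u (C : R[i]) :
  0 < C -> (forall e, 0 < e -> bnd u (C * e)) -> u = 0.
Proof.
move=> C0 h; apply: bnd_eq0 => e e0.
by have := h (C^-1 * e); rewrite mulVKf ?gt_eqF //; apply; rewrite mulr_gt0 ?invr_gt0.
Qed.

Lemma bnd_closed u c : (forall e, 0 < e -> bnd u (c + e)) -> bnd u c.
Proof.
move=> h; split=> [|x].
  by apply/ler_addgt0Pr => e e0; case: (h e e0).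
apply/ler_addgt0Pr => e e0; have x1 : 0 < `|x| + 1 by rewrite ltr_wpDl.
have [|_ hx] := h (e / (`|x| + 1)); first by rewrite divr_gt0.
apply: le_trans (hx x) _; rewrite mulrDl lerD2l -mulrA ler_piMr ?(ltW e0) //.
by rewrite mulrC ler_pdivrMr // mul1r lerDl.
Qed.

Lemma scale_half (V : lmodType R[i]) (v : V) : 2^-1 *: (v + v) = v.
Proof. by rewrite scalerDr -scalerDl -[2^-1]mul1r -splitr scale1r. Qed.

(** Visser's iteration [y <- (k + y^2) / 2] for [Y = 1 - sqrt (1 - k)]. Since
    [y_n] is a polynomial in [k] with nonnegative coefficients, [|y_n - y_m|] is
    bounded by the same difference for the scalar iteration with [k = 1]. The
    latter tends to 1 at the rate [2 / (n + 2)], which gives convergence up to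
    and including [|k| = 1]. *)
Section Visser.
Variable k : U.
Hypotheses (k_sa : ustar k = k) (k1 : bnd k 1).

Let y n : U := iter n (fun y => 2^-1 *: (k + y * y)) 0.
Let eta n : R[i] := iter n (fun x => 2^-1 * (1 + x * x)) 0.

Let etaS n : eta n.+1 = 2^-1 * (1 + eta n * eta n). Proof. by []. Qed.
Let half0 : 0 <= 2^-1 :> R[i]. Proof. by rewrite invr_ge0. Qed.

Let bnd_half u c : bnd u c -> bnd (2^-1 *: u) (2^-1 * c).
Proof. by move/(bndZ 2^-1); rewrite ger0_norm. Qed.

Let y_bnd n : bnd (y n) (eta n).
Proof.
elim: n => [|n IH] /=; first exact: bnd0.
by apply: bnd_half; apply: bndD => //; exact: bndM.
Qed.

Let y_step n : bnd (y n.+1 - y n) (eta n.+1 - eta n).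
Proof.
elim: n => [|n IH].
  rewrite /= subr0 subr0 !mulr0 !addr0.
  exact: bnd_half.
have -> : y n.+2 - y n.+1
    = 2^-1 *: (y n.+1 * (y n.+1 - y n) + (y n.+1 - y n) * y n).
  rewrite mulrBr mulrBl addrA subrK -[y n.+2]/(2^-1 *: (k + y n.+1 * y n.+1)).
  by rewrite -[in X in _ - X]/(2^-1 *: (k + y n * y n)) -scalerBr opprD
    addrACA subrr add0r.
have -> : eta n.+2 - eta n.+1 = 2^-1 *
    (eta n.+1 * (eta n.+1 - eta n) + (eta n.+1 - eta n) * eta n).
  by rewrite (etaS n.+1) (etaS n); move: (eta n) => z; field.
by apply: bnd_half; apply: bndD; exact: bndM.
Qed.

Let y_dist m n : (m <= n)%N -> bnd (y n - y m) (eta n - eta m).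
Proof.
move=> /subnK <-; elim: (n - m)%N => [|d IH].
  by rewrite !subrr; exact: bnd0.
have dist (V : zmodType) (p q r : V) : p - r = (p - q) + (q - r).
  by rewrite addrA subrK.
by rewrite addSn (dist _ _ (y (d + m))) (dist _ _ (eta (d + m))); exact: bndD.
Qed.

Let eta_rate n : 0 <= 1 - eta n <= 2 / n.+2%:R.
Proof.
elim: n => [|n]; first by rewrite /eta /= subr0 ler01 divff ?pnatr_eq0 /=.
have -> : 1 - eta n.+1 = (1 - eta n) * (1 - 2^-1 * (1 - eta n)).
  by rewrite etaS; move: (eta n) => z; field.
move: (1 - eta n) => x /andP[x0 x_le].
have hx : 2 / n.+2%:R <= 1 :> R[i] by rewrite ler_pdivrMr ?ltr0n // mul1r ler_nat.
have n0 i : i.+1%:R != 0 :> R[i] by rewrite pnatr_eq0.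
set r := 2 / n.+2%:R in hx x_le.
have x1 : x <= 1 by exact: le_trans hx.
apply/andP; split.
  rewrite mulr_ge0 // subr_ge0 mulrC ler_pdivrMr // mul1r.
  by apply: le_trans x1 _; rewrite ler1n.
apply: (@le_trans _ _ (r * (1 - 2^-1 * r))).
  rewrite -subr_ge0.
  have -> : r * (1 - 2^-1 * r) - x * (1 - 2^-1 * x)
      = (r - x) * (1 - 2^-1 * (r + x)) by field.
  rewrite mulr_ge0 ?subr_ge0 // mulrC ler_pdivrMr // mul1r -[2]/(1 + 1).
  exact: lerD.
rewrite -subr_ge0.
have -> : 2 / n.+3%:R - r * (1 - 2^-1 * r)
    = 2 / (n.+2%:R * n.+2%:R * n.+3%:R) :> R[i].
  rewrite /r; have := n0 n.+2; have := n0 n.+1; rewrite -[n.+3]addn1 natrD.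
  by move: n.+2%:R => N N0 N1; field; rewrite N0 N1.
by rewrite divr_ge0 // !mulr_ge0.
Qed.

Lemma visser : exists Y : U, [/\ ustar Y = Y, bnd Y 1, Y + Y = k + Y * Y
  & forall g, g * k = k * g -> g * Y = Y * g].
Proof.
have eta1 n : eta n <= 1 by have /andP[] := eta_rate n; rewrite subr_ge0.
have [||L hL] := @unitz_complete _ _ y (fun m => 1 - eta m).
- by move=> m n mn; apply: bndW (y_dist mn); rewrite lerD2r.
- move=> e e0; have [N hN] := complex_archi e0; exists N => n Nn.
  by have /andP[_ /le_lt_trans] := eta_rate n; apply; exact: hN.
have hL1 e : 0 < e -> exists n, bnd (y n - L) e.
  by move=> e0; have [N hN] := hL e e0; exists N; exact: hN.
have y1 n : bnd (y n) 1 by exact: bndW (y_bnd n).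
have L1 : bnd L 1.
  apply: bnd_closed => e /hL1[n hn].
  by rewrite -(subKr (y n) L); exact: bndB.
exists L; split=> //.
- apply/eqP; rewrite -subr_eq0; apply/eqP; apply: (@bnd_small_eq0 _ 2) => //.
  move=> e /hL1[n hn]; rewrite mulr_natl mulr2n.
  have ysa m : ustar (y m) = y m.
    elim: m => [|m IH]; first exact: ustar0.
    by rewrite -[y m.+1]/(2^-1 *: (k + y m * y m)) ustarZ ustarD ustarM IH k_sa
      fmorphV rmorph_nat.
  have -> : ustar L - L = (y n - L) - ustar (y n - L).
    by rewrite ustarB ysa opprB [RHS]addrC addrA subrK.
  by apply: bndB => //; exact: bnd_star.
- apply/eqP; rewrite -subr_eq0; apply/eqP; apply: (@bnd_small_eq0 _ 4) => //.
  move=> e e0; have [N hN] := hL e e0.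
  have hn := hN N (leqnn N); have hSn := hN N.+1 (leqnSn N).
  set n := N in hn hSn *.
  have -> : L + L - (k + L * L) = (y n * (y n - L) + (y n - L) * L)
      - ((y n.+1 - L) + (y n.+1 - L)).
    have -> : k = y n.+1 + y n.+1 - y n * y n.
      rewrite -[y n.+1]/(2^-1 *: (k + y n * y n)) -scalerDr scale_half.
      by rewrite addrK.
    have zmod (V : zmodType) (a b c d : V) :
        a - (b - c + d) = c - d - (b - a).
      by rewrite opprD !opprB [RHS]addrACA !addrA [a + c]addrC [LHS]addrAC.
    by rewrite zmod mulrBr mulrBl addrA subrK [X in _ = _ - X]addrACA -opprD.
  have -> : 4 * e = (1 * e + e * 1) + (e + e) by ring.
  by apply: bndB; apply: bndD => //; exact: bndM.
- move=> g gk; have [c c0 gc] := bnd_ex g.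
  apply/eqP; rewrite -subr_eq0; apply/eqP.
  apply: (@bnd_small_eq0 _ (2 * c)); first by rewrite mulr_gt0.
  move=> e /hL1[n hn].
  have gy m : g * y m = y m * g.
    elim: m => [|m IH]; first by rewrite mulr0 mul0r.
    rewrite -[y m.+1]/(2^-1 *: (k + y m * y m)) -scalerAr -scalerAl.
    by rewrite mulrDl mulrDr gk mulrA IH -mulrA IH mulrA.
  have -> : g * L - L * g = (y n - L) * g - g * (y n - L).
    by rewrite mulrBl mulrBr gy opprB [RHS]addrC addrA subrK.
  have -> : 2 * c * e = e * c + c * e by ring.
  by apply: bndB; exact: bndM.
Qed.

End Visser.

(** Positivity, expressed by the norm: for self-adjoint [h], [|t - h| <= t] means
    that the spectrum of [h] lies in the interval from 0 to [2 t]. Sums of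
    positive elements are positive by the triangle inequality. *)
Definition spos h : Prop :=
  ustar h = h /\ exists2 t, 0 < t & bnd (t *: 1 - h) t.

Lemma spos0 : spos 0.
Proof.
split; first exact: ustar0.
by exists 1 => //; rewrite subr0; exact: bnd_cst.
Qed.

Lemma sposD u v : spos u -> spos v -> spos (u + v).
Proof.
move=> [us [t t0 ut]] [vs [r r0 vr]]; split; first by rewrite ustarD us vs.
exists (t + r); first exact: addr_gt0.
by rewrite scalerDl opprD addrACA; exact: bndD.
Qed.

Lemma sposZ c u : 0 < c -> spos u -> spos (c *: u).
Proof.
move=> c0 [us [t t0 ut]]; split.
  by rewrite ustarZ us geC0_conj ?ltW.
exists (c * t); first exact: mulr_gt0.
rewrite -scalerA -scalerBr; have := bndZ c ut.
by rewrite gtr0_norm.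
Qed.

Lemma spos_cstB c u : ustar u = u -> bnd u c -> spos (c *: 1 - u).
Proof.
move=> us uc; have := bnd_ge0 uc; rewrite le_eqVlt => /predU1P[c0|c0].
  by rewrite -c0 in uc *; rewrite (bnd_eq00 uc) subr0 scale0r; exact: spos0.
split; first by rewrite ustarB us ustarZ ustar1 geC0_conj // ltW.
by exists c => //; rewrite subKr.
Qed.

Lemma spos_sqrt h : spos h -> exists s : U,
  [/\ ustar s = s, spos s, s * s = h & forall g, g * h = h * g -> g * s = s * g].
Proof.
move=> [hs [t t0 ht]].
have tn : t != 0 by rewrite gt_eqF.
have ts : Num.conj t^-1 = t^-1 by rewrite geC0_conj // invr_ge0 ltW.
have [|| Y [Ys Y1 Yk Yg]] := @visser (1 - t^-1 *: h).
- by rewrite ustarB ustar1 ustarZ hs ts.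
- have := bndZ t^-1 ht; rewrite scalerBr scalerA mulVf // scale1r.
  by rewrite gtr0_norm ?invr_gt0 // mulVf.
have r0 : 0 < sqrtC t by rewrite sqrtC_gt0.
have Y_pos : spos (1 - Y) by rewrite -[1 in X in X - _]scale1r; exact: spos_cstB.
exists (sqrtC t *: (1 - Y)); split.
- by case: (sposZ r0 Y_pos).
- exact: sposZ.
- rewrite -scalerAl -scalerAr scalerA -expr2 sqrtCK.
  rewrite mulrBl mul1r mulrBr mulr1.
  have -> : 1 - Y - (Y - Y * Y) = t^-1 *: h.
    by rewrite opprB addrACA -opprD Yk opprD addrACA subrr addr0 subKr.
  by rewrite scalerA divff // scale1r.
- move=> g gh; rewrite -scalerAr -scalerAl mulrBr mulrBl mulr1 mul1r Yg //.
  by rewrite mulrBr mulrBl mulr1 mul1r -scalerAr -scalerAl gh.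
Qed.

Lemma mulCii : 'i * 'i = -1 :> R[i].
Proof. by rewrite -expr2 sqrCi. Qed.

(** When [r] and [q] are commuting and self-adjoint, [r + iq] is normal, with
    [r] as its real part and [r * r + q * q] as the square of its modulus. *)
Lemma bnd_normal_part (r q : U) c : ustar r = r -> ustar q = q -> r * q = q * r ->
  0 <= c -> bnd (r * r + q * q) (c ^+ 2) -> bnd r c.
Proof.
move=> rs qs rq c0 h; pose f := r + 'i *: q.
have fs : ustar f = r - 'i *: q.
  by rewrite ustarD ustarZ rs qs conjCi scaleNr.
have fc : bnd f c.
  apply: bnd_cstar => //; rewrite fs mulrBl !mulrDr.
  rewrite -!scalerAl -!scalerAr scalerA mulCii scaleN1r rq.
  by rewrite opprD opprK addrA addrK.
have -> : r = 2^-1 *: (f + ustar f).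
  by rewrite fs addrACA subrr addr0 scale_half.
have := bndZ 2^-1 (bndD fc (bnd_star fc)).
by rewrite ger0_norm ?invr_ge0 // mulrDr [2^-1 * _]mulrC -splitr.
Qed.

(** If [|s| <= c] and [q] is the square root of [c^2 - s^2], the normal element
    [q + is] has modulus [c], so that [|q| <= c]. *)
Lemma spos_sq s : ustar s = s -> spos (s * s).
Proof.
move=> ss; have sss : ustar (s * s) = s * s by rewrite ustarM ss.
have [c c0 sc] := bnd_ex s; split=> //; exists (c ^+ 2); first exact: exprn_gt0.
have s2 : bnd (s * s) (c ^+ 2) by rewrite expr2; exact: bndM.
have [q [qs _ qq qg]] := spos_sqrt (spos_cstB sss s2).
rewrite -qq expr2; suff qc : bnd q c by exact: bndM.
apply: (bnd_normal_part (q := s)) => //.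
- by apply/esym/qg; rewrite mulrBl mulrBr -scalerAl -scalerAr mulr1 mul1r mulrA.
- exact: ltW.
by rewrite qq subrK; apply: bnd_cst; rewrite exprn_ge0 // ltW.
Qed.

(** The roots [r] of [u] and [q] of [c - u] form the normal element [r + iq] of
    modulus [sqrt c]. *)
Lemma spos_le_bnd u c : spos u -> spos (c *: 1 - u) -> 0 <= c -> bnd u c.
Proof.
move=> up cup c0; have [r [rs _ rr rg]] := spos_sqrt up.
have [q [qs _ qq qg]] := spos_sqrt cup.
rewrite -rr -[c]sqrtCK expr2; suff rc : bnd r (sqrtC c) by exact: bndM.
apply: (bnd_normal_part (q := q)) => //.
- by apply: qg; rewrite mulrBl mulrBr -scalerAl -scalerAr mulr1 mul1r -rr mulrA.
- by rewrite sqrtC_ge0.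
by rewrite rr qq addrCA subrr addr0 sqrtCK; exact: bnd_cst.
Qed.

Lemma spos_mono u v c : spos u -> spos v -> bnd (u + v) c -> bnd u c.
Proof.
move=> up vp h; apply: spos_le_bnd => //; last exact: bnd_ge0 h.
have -> : c *: 1 - u = (c *: 1 - (u + v)) + v by rewrite opprD addrA subrK.
apply: sposD => //; apply: spos_cstB => //.
by case: up => us _; case: vp => vs _; rewrite ustarD us vs.
Qed.

Lemma spos_anti u : spos u -> spos (- u) -> u = 0.
Proof.
move=> up nup; apply: bnd_eq00; apply: spos_mono up nup _.
by rewrite subrr; exact: bnd0.
Qed.

Lemma cstar_mul_eq0 u : ustar u * u = 0 -> u = 0.
Proof.
move=> h; apply: bnd_eq00; apply: bnd_cstar => //.
by rewrite h expr0n; exact: bnd0.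
Qed.

(** The sum is half the sum of the squares of the self-adjoint elements [u + u^*]
    and [i (u - u^* )]. *)
Lemma spos_cstar_sum u : spos (ustar u * u + u * ustar u).
Proof.
pose p := u + ustar u; pose q := 'i *: (u - ustar u).
have ps : ustar p = p by rewrite ustarD ustarK addrC.
have qs : ustar q = q.
  by rewrite ustarZ ustarB ustarK conjCi scaleNr -scalerN opprB.
have -> : ustar u * u + u * ustar u = 2^-1 *: (p * p + q * q).
  rewrite -scalerAl -scalerAr scalerA mulCii scaleN1r.
  have -> : p * p = (ustar u * u + u * ustar u) + (u * u + ustar u * ustar u).
    rewrite mulrDl !mulrDr [X in X + _ = _]addrC [LHS]addrACA.
    by rewrite [X in X + _ = _]addrC.
  have -> : (u - ustar u) * (u - ustar u)
      = (u * u + ustar u * ustar u) - (ustar u * u + u * ustar u).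
    by rewrite mulrBl !mulrBr opprB addrACA -opprD [X in _ - X = _]addrC.
  by rewrite opprB addrACA subrr addr0 scale_half.
apply: sposZ; first by rewrite invr_gt0.
by apply: sposD; exact: spos_sq.
Qed.

(** For [d = u s], [d^* d = - s^4] and [d d^* = - (u u^* )^2] are both negative,
    although their sum is positive; so both vanish. *)
Lemma cstar_neg_sq u s : ustar s = s -> ustar u * u = - (s * s) -> s * s = 0.
Proof.
move=> ss us; pose x := (s * s) * (s * s).
pose y := (u * ustar u) * (u * ustar u).
have xp : spos x by apply: spos_sq; rewrite ustarM ss.
have yp : spos y by apply: spos_sq; rewrite ustarM ustarK.
have := spos_cstar_sum (u * s).
have -> : ustar (u * s) * (u * s) = - x.
  by rewrite ustarM ss mulrA -(mulrA s) us mulrN mulNr /x !mulrA.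
have -> : u * s * ustar (u * s) = - y.
  by rewrite ustarM ss mulrA -(mulrA u) -[s * s]opprK -us mulrN mulNr /y !mulrA.
rewrite -opprD => nxy; have xy : x + y = 0 by apply: spos_anti => //; exact: sposD.
have : x = 0.
  apply: spos_anti => //; suff -> : - x = y by [].
  by apply/eqP; rewrite eq_sym -addr_eq0 addrC xy.
move=> x0; apply: cstar_mul_eq0.
by rewrite ustarM ss.
Qed.

(** Let [h = u^* u], [m = |h|] and [v = m - h], twice the negative part of [h].
    Then [h v = - m v], so that [(u v)^* (u v) = - v m v] is minus the square of
    the self-adjoint element [w v] with [w = sqrt m]. By the previous lemma
    [w v = 0]; hence [v^2 = 2 m v = 0] and [h = m]. *)
Lemma spos_cstar_mul u : spos (ustar u * u).
Proof.
set h := ustar u * u; have hs : ustar h = h by rewrite ustarM ustarK.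
have [m [ms mp mm mg]] := spos_sqrt (spos_sq hs).
have mh : h * m = m * h by apply: mg; rewrite mulrA.
have [w [ws _ ww wg]] := spos_sqrt mp.
pose v := m - h.
have vs : ustar v = v by rewrite ustarB ms hs.
have wh : h * w = w * h by exact: wg.
have wm : m * w = w * m by exact: wg.
have wv : w * v = v * w by rewrite mulrBr mulrBl wh wm.
have hv : h * v = - (m * v).
  by rewrite !mulrBr mh mm opprB.
have vm : v * m = m * v by rewrite mulrBr mulrBl mh.
have wvs : ustar (w * v) = w * v by rewrite ustarM ws vs wv.
have uv : ustar (u * v) * (u * v) = - ((w * v) * (w * v)).
  rewrite ustarM vs mulrA -(mulrA v) -/h -mulrA hv mulrN; congr (- _).
  by rewrite {1}wv -!mulrA [w * (w * v)]mulrA ww.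
have v3 := cstar_neg_sq wvs uv.
have wv0 : w * v = 0 by apply: cstar_mul_eq0; rewrite wvs.
have v0 : v = 0.
  apply: cstar_mul_eq0; rewrite vs mulrBl hv opprK -mulr2n.
  by rewrite -ww -mulrA wv0 mulr0 mul0rn.
by have <- : m = h by apply/eqP; rewrite -subr_eq0 -/v v0.
Qed.

End Positivity.
(** * Order and norm on Hilbert modules *)

Section CPos.
Context (R : realType) (A : cstarType R).
Implicit Types (a b p : A) (c : R[i]).

Lemma uembD a b : uemb (a + b) = uemb a + uemb b.
Proof. by congr pair; rewrite /= ?addr0. Qed.

Lemma uembN a : uemb (- a) = - uemb a.
Proof. by congr pair; rewrite /= ?oppr0. Qed.

Lemma uembM a b : uemb (cmul a b) = uemb a * uemb b.
Proof. by congr pair; rewrite /= ?mul0r // !scale0r !add0r. Qed.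

Lemma uemb_star a : uemb (cstar a) = ustar (uemb a).
Proof. by congr pair; rewrite /= ?rmorph0. Qed.

Lemma uembZ c a : uemb (c *: a) = c *: uemb a.
Proof. by congr pair; rewrite /= ?mulr0. Qed.

(** Conversely, a square root of [(0, a)] has scalar part 0, hence lies in the
    algebra. *)
Lemma cposP a : cpos a <-> spos (uemb a).
Proof.
split=> [[b ->]|]; first by rewrite uembM uemb_star; exact: spos_cstar_mul.
move=> /spos_sqrt[s [ss _ sa _]]; exists s.2.
have s1 : s.1 = 0.
  by apply/eqP; rewrite -[_ == 0]orbb -mulf_eq0 -[_ * _]/((s * s).1) sa.
have s2 : cstar s.2 = s.2 := congr1 snd ss.
by have /= := congr1 snd sa; rewrite s1 !scale0r !add0r s2.
Qed.

Lemma cposD a b : cpos a -> cpos b -> cpos (a + b).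
Proof. by rewrite !cposP uembD; exact: sposD. Qed.

Lemma cposZ c a : 0 < c -> cpos a -> cpos (c *: a).
Proof. by rewrite !cposP uembZ; exact: sposZ. Qed.

Lemma cpos_mul b : cpos (cmul (cstar b) b).
Proof. by exists b. Qed.

Lemma cpos_mono a b : cpos a -> cpos b -> `|a| <= `|a + b|.
Proof.
move=> /cposP ap /cposP bp; apply/bnd_emb.
by apply: spos_mono ap bp _; rewrite -uembD; apply/bnd_emb.
Qed.

(** With [1 - p = q^2] in the unitization, the element is [(q a)^* (q a)]. *)
Lemma cpos_contraction p a : cpos p -> `|p| <= 1 ->
  cpos (cmul (cstar a) a - cmul (cstar a) (cmul p a)).
Proof.
move=> /cposP[ps pt] /bnd_emb p1.
have [q [qs _ qq _]] := spos_sqrt (spos_cstB ps p1).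
apply/cposP; rewrite uembD uembN !uembM uemb_star.
have -> : ustar (uemb a) * uemb a - ustar (uemb a) * (uemb p * uemb a)
    = ustar (q * uemb a) * (q * uemb a).
  rewrite ustarM qs [RHS]mulrA -[X in _ = X * _]mulrA qq -mulrBr scale1r -mulrA.
  by rewrite mulrBl mul1r.
exact: spos_cstar_mul.
Qed.

End CPos.

Section InnerScale.
Context (R : realType) (A : cstarType R) (H : innerModType A).
Implicit Types x y : H.

Lemma innerZl (z : R[i]) x y :
  inner (z *: x) y = Num.conj z *: inner x y :> A.
Proof. by rewrite inner_star innerZr cstarZ -inner_star. Qed.

Lemma inner_actl x y (a : A) :
  inner (act x a) y = cmul (cstar a) (inner x y) :> A.
Proof. by rewrite inner_star inner_act cstarM -inner_star. Qed.

Lemma hnorm_ge0 x : 0 <= hnorm x.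
Proof. by rewrite sqrtC_ge0. Qed.

Lemma hnorm_sqr x : hnorm x ^+ 2 = `|inner x x : A|.
Proof. by rewrite sqrtCK. Qed.

Lemma hnorm_scale (z : R[i]) x : hnorm (z *: x) = `|z| * hnorm x.
Proof.
apply/eqP; rewrite -(eqrXn2 (n := 2)) ?mulr_ge0 ?hnorm_ge0 //.
rewrite exprMn !hnorm_sqr innerZl innerZr scalerA normrZ -normCKC.
by rewrite ger0_norm // exprn_ge0.
Qed.

Lemma hnorm_opp x : hnorm (- x) = hnorm x.
Proof. by rewrite -scaleN1r hnorm_scale normrN1 mul1r. Qed.

Lemma hnorm0 : hnorm (0 : H) = 0.
Proof. by rewrite /hnorm inner0r normr0 sqrtC0. Qed.

Lemma hdistC x y : hnorm (x - y) = hnorm (y - x).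
Proof. by rewrite -hnorm_opp opprB. Qed.

End InnerScale.

Lemma hnorm_mono (R : realType) (A : cstarType R) (H K : innerModType A)
    (w : K) (x : H) (p : A) :
  cpos p -> cpos (inner w w : A) ->
  inner x x = inner w w + p :> A -> hnorm w <= hnorm x.
Proof.
move=> pp wp xx; rewrite -(ler_pXn2r (n := 2)) ?nnegrE ?hnorm_ge0 //.
by rewrite !hnorm_sqr xx; exact: cpos_mono.
Qed.

Section HilbertNorm.
Context (R : realType) (A : cstarType R) (H : hilbertModType A).
Implicit Types x y z : H.

Lemma hnorm_eq0 x : hnorm x = 0 -> x = 0.
Proof.
move=> x0; apply: inner_eq0; apply/eqP.
by rewrite -normr_eq0 -hnorm_sqr x0 expr0n.
Qed.

(** Let [t = |<x, x>|], [<x, x> = t p] and [<x, y> = t a]. Then [<y, y>] is the sum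
    of the positive elements [t a^* a], [<y - x a, y - x a>] and
    [t a^* (1 - p) a], so its norm is at least that of the first. *)
Lemma cauchy_schwarz x y : `|inner x y : A| <= hnorm x * hnorm y.
Proof.
have [x0|x0] := eqVneq (hnorm x) 0.
  by rewrite (hnorm_eq0 x0) inner0l normr0 hnorm0 mul0r.
have t0 : 0 < hnorm x ^+ 2 by rewrite exprn_gt0 // lt_def x0 hnorm_ge0.
set t := hnorm x ^+ 2 in t0; have tn : t != 0 by rewrite gt_eqF.
have tc : Num.conj t = t by rewrite geC0_conj // ltW.
have [a xy] : exists a : A, inner x y = t *: a.
  by exists (t^-1 *: inner x y); rewrite scalerA divff // scale1r.
have yx : inner y x = t *: cstar a :> A by rewrite inner_star xy cstarZ tc.
have [p xx] : exists p : A, inner x x = t *: p.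
  by exists (t^-1 *: inner x x); rewrite scalerA divff // scale1r.
have pE : p = t^-1 *: inner x x by rewrite xx scalerA mulVf // scale1r.
have p1 : `|p| <= 1.
  by rewrite pE normrZ -hnorm_sqr gtr0_norm ?invr_gt0 // mulVf.
have pp : cpos p by rewrite pE; apply: cposZ; [rewrite invr_gt0|exact: inner_ge0].
have dec : inner y y = t *: cmul (cstar a) a +
    (inner (y - act x a) (y - act x a) +
     t *: (cmul (cstar a) a - cmul (cstar a) (cmul p a))) :> A.
  rewrite innerDr innerNr !innerDl !innerNl !inner_act !inner_actl xx xy yx.
  rewrite !cmulZl !cmulZr !cmulZl -cmulA -!scalerBr subrK.
  by rewrite addrC subrK.
have := cpos_mono (cposZ t0 (cpos_mul a))
  (cposD (inner_ge0 (y - act x a)) (cposZ t0 (cpos_contraction a pp p1))).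
rewrite -dec => h.
rewrite -(ler_pXn2r (n := 2)) ?nnegrE ?mulr_ge0 ?hnorm_ge0 //.
rewrite exprMn -/t hnorm_sqr xy normrZ exprMn gtr0_norm //.
rewrite [t ^+ 2]expr2 -mulrA ler_pM2l //.
by apply: le_trans h; rewrite normrZ gtr0_norm // cnorm_star.
Qed.

Lemma ler_hnormD x y : hnorm (x + y) <= hnorm x + hnorm y.
Proof.
rewrite -(ler_pXn2r (n := 2)) ?nnegrE ?addr_ge0 ?hnorm_ge0 //.
rewrite hnorm_sqr innerDl !innerDr.
have -> : (hnorm x + hnorm y) ^+ 2 = (hnorm x ^+ 2 + hnorm x * hnorm y)
    + (hnorm y * hnorm x + hnorm y ^+ 2) by ring.
apply: le_trans (ler_normD _ _) _; rewrite !hnorm_sqr.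
by apply: lerD; apply: le_trans (ler_normD _ _) _; apply: lerD => //;
  exact: cauchy_schwarz.
Qed.

Lemma ler_hnormB x y : hnorm (x - y) <= hnorm x + hnorm y.
Proof. by rewrite -(hnorm_opp y); exact: ler_hnormD. Qed.

End HilbertNorm.
Section PairHilbert.
Context (R : realType) (A : cstarType R) (H1 H2 : hilbertModType A).
Local Notation H := (H1 * H2)%type.
Implicit Types x : H.

Lemma inner_pair x y : inner x y = inner x.1 y.1 + inner x.2 y.2 :> A.
Proof. by []. Qed.

Let pair_ge0 x : cpos (inner x x : A).
Proof. by rewrite inner_pair; apply: cposD; exact: inner_ge0. Qed.

Lemma hnorm_fst x : hnorm x.1 <= hnorm x.
Proof.
by apply: (hnorm_mono (inner_ge0 x.2)) => //; exact: inner_ge0.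
Qed.

Lemma hnorm_snd x : hnorm x.2 <= hnorm x.
Proof.
apply: (hnorm_mono (inner_ge0 x.1)); first exact: inner_ge0.
by rewrite inner_pair addrC.
Qed.

Lemma hnorm_pair x : hnorm x <= hnorm x.1 + hnorm x.2.
Proof.
rewrite -(ler_pXn2r (n := 2)) ?nnegrE ?addr_ge0 ?hnorm_ge0 //.
rewrite hnorm_sqr inner_pair; apply: le_trans (ler_normD _ _) _.
rewrite -!hnorm_sqr sqrrD addrAC lerDl mulrn_wge0 //.
by rewrite mulr_ge0 ?hnorm_ge0.
Qed.

Let pair_eq0 x : inner x x = 0 :> A -> x = 0.
Proof.
move=> x0; have h0 : hnorm x = 0 by rewrite /hnorm x0 normr0 sqrtC0.
case: x {x0} h0 (hnorm_fst x) (hnorm_snd x) => a b -> /= ha hb.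
by congr pair; apply: hnorm_eq0; apply/eqP; rewrite eq_le hnorm_ge0 ?ha ?hb.
Qed.

Let pair_complete (u : nat -> H) :
  (forall e : R[i], 0 < e -> exists N, forall m n, (N <= m)%N -> (N <= n)%N ->
     hnorm (u m - u n) < e) ->
  exists l : H, forall e : R[i], 0 < e -> exists N, forall n, (N <= n)%N ->
     hnorm (u n - l) < e.
Proof.
move=> hu.
have [|a ha] := @hcomplete R A H1 (fun n => (u n).1).
  move=> e /hu[N hN]; exists N => m n Nm Nn.
  exact: le_lt_trans (hnorm_fst (u m - u n)) (hN m n Nm Nn).
have [|b hb] := @hcomplete R A H2 (fun n => (u n).2).
  move=> e /hu[N hN]; exists N => m n Nm Nn.
  exact: le_lt_trans (hnorm_snd (u m - u n)) (hN m n Nm Nn).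
exists (a, b) => e e0; have e2 : 0 < e / 2 by rewrite divr_gt0.
have [N hN] := ha _ e2; have [M hM] := hb _ e2.
exists (maxn N M) => n; rewrite geq_max => /andP[/hN an /hM bn].
apply: le_lt_trans (hnorm_pair (u n - (a, b))) _.
by rewrite [ltRHS]splitr ltrD.
Qed.

HB.instance Definition _ := isHilbertModule.Build R A H
  pair_ge0 pair_eq0 pair_complete.

End PairHilbert.

(** * Geometric convergence and uniform boundedness *)

Section Limits.
Context (R : realType).

Lemma complex_nat_bound (c : R[i]) : 0 <= c -> exists n, c < n%:R.
Proof.
move=> c0; have c1 : 0 < c + 1 by rewrite ltr_wpDl.
have [|N hN] := @complex_archi R (2 / (c + 1)); first by rewrite divr_gt0.
exists N.+1; have := hN N (leqnn N).
by rewrite ltr_pM2l // ltf_pV2 ?posrE // -natr1 ltrD2r.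
Qed.

Lemma geometric_small (C e : R[i]) : 0 <= C -> 0 < e ->
  exists N, forall n, (N <= n)%N -> C * 3^-1 ^+ n < e.
Proof.
move=> C0 e0; have [|N hN] := @complex_nat_bound (C / e).
  by rewrite divr_ge0 // ltW.
exists N => n Nn; rewrite exprVn ltr_pdivrMr ?exprn_gt0 // mulrC -ltr_pdivrMr //.
apply: lt_le_trans hN _; rewrite -natrX ler_nat.
by apply: leq_trans Nn _; exact/ltnW/ltn_expl.
Qed.

Context (A : cstarType R) (H : hilbertModType A).
Implicit Types (x y z : H).

Lemma geometric_cvg (u : nat -> H) (C : R[i]) : 0 <= C ->
  (forall n, hnorm (u n.+1 - u n) <= C * 3^-1 ^+ n) ->
  exists l, forall n, hnorm (u n - l) <= 3 / 2 * C * 3^-1 ^+ n.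
Proof.
move=> C0 hu; pose D : R[i] := 3 / 2 * C.
have D0 : 0 <= D by rewrite mulr_ge0 // divr_ge0.
have q0 n : 0 <= D * 3^-1 ^+ n by rewrite mulr_ge0 // exprn_ge0 // invr_ge0.
have dist n d : hnorm (u (d + n)%N - u n) <= D * 3^-1 ^+ n - D * 3^-1 ^+ (d + n).
  elim: d => [|d IH]; first by rewrite !subrr hnorm0.
  have -> : u (d.+1 + n)%N - u n = (u (d + n).+1 - u (d + n)%N) + (u (d + n)%N - u n).
    by rewrite addrA subrK.
  apply: le_trans (ler_hnormD _ _) _; apply: le_trans (lerD (hu _) IH) _.
  rewrite addSn exprS /D; move: (3^-1 ^+ n) (3^-1 ^+ (d + n)) => s t.
  by rewrite le_eqVlt; apply/orP; left; apply/eqP; field; rewrite ?pnatr_eq0.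
have dist' n m : (n <= m)%N -> hnorm (u m - u n) <= D * 3^-1 ^+ n.
  move=> /subnK <-; apply: le_trans (dist _ _) _.
  by rewrite lerBlDr lerDl.
have [|l hl] := @hcomplete R A H u.
  move=> e e0; have [|N hN] := @geometric_small D (e / 2) D0.
    by rewrite divr_gt0.
  exists N => m n Nm Nn.
  have -> : u m - u n = (u m - u N) - (u n - u N) by rewrite opprB addrA subrK.
  apply: le_lt_trans (ler_hnormB _ _) _; rewrite [ltRHS]splitr.
  by apply: ltrD; apply: le_lt_trans (dist' _ _ _) (hN _ (leqnn N)).
exists l => n; apply/ler_addgt0Pr => e /hl[N hN].
have -> : u n - l = (u (maxn n N) - l) - (u (maxn n N) - u n).
  by rewrite opprB [RHS]addrC addrA subrK.
apply: le_trans (ler_hnormB _ _) _; rewrite addrC; apply: lerD.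
  by apply: dist'; rewrite leq_maxl.
by apply/ltW/hN; rewrite leq_maxr.
Qed.

Record closed_submodule (F : H -> Prop) : Prop := ClosedSubmodule {
  csub0 : F 0 ;
  csubD : forall x y, F x -> F y -> F (x + y) ;
  csubZ : forall (c : R[i]) x, F x -> F (c *: x) ;
  csub_closed : forall x,
    (forall e : R[i], 0 < e -> exists2 y, F y & hnorm (y - x) < e) -> F x
}.

Lemma csubB F x y : closed_submodule F -> F x -> F y -> F (x - y).
Proof.
by move=> cF Fx Fy; apply: csubD => //; rewrite -scaleN1r; exact: csubZ.
Qed.

Lemma closed_submoduleT : closed_submodule (fun=> True).
Proof. by []. Qed.

Lemma geometric_csub F (u : nat -> H) (C : R[i]) l : closed_submodule F ->
  0 <= C -> (forall n, hnorm (u n - l) <= C * 3^-1 ^+ n) ->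
  (forall n, F (u n)) -> F l.
Proof.
move=> cF C0 hl Fu; apply: (csub_closed cF) => e e0.
have [N hN] := geometric_small C0 e0; exists (u N) => //.
exact: le_lt_trans (hl N) (hN N (leqnn N)).
Qed.

(** Gliding hump: choose [y_n] in [S] with [|y_n| > 2 n 3^n]. Signs can be chosen
    in the series with terms [+-3^-n y_n / |y_n|] so that the partial sum
    [x_(n+1)] satisfies [|<y_n, x_(n+1)>| >= 3^-n |y_n|]. The tail has norm at most
    [3^-n / 2], so the sum [l] satisfies [|<y_n, l>| >= 3^-n |y_n| / 2 >= n]. *)
Lemma uniform_boundedness (F S : H -> Prop) : closed_submodule F ->
  (forall y, S y -> F y) ->
  (forall z, F z -> exists c : R[i], forall y, S y -> `|inner y z : A| <= c) ->
  exists2 M : R[i], 0 <= M & forall y, S y -> hnorm y <= M.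
Proof.
move=> cF SF pb; apply: contrapT => unb.
have /choice[y hy] : forall n, exists y, S y /\ 2 * n%:R * 3 ^+ n < hnorm y.
  move=> n.
  have B0 : 0 <= 2 * n%:R * 3 ^+ n :> R[i] by rewrite !mulr_ge0 // exprn_ge0.
  apply: contrapT => hn; apply: unb; exists (2 * n%:R * 3 ^+ n) => // z Sz.
  rewrite (real_leNgt (ger0_real (hnorm_ge0 z)) (ger0_real B0)).
  by apply/negP => zn; apply: hn; exists z.
have y0 n : 0 < hnorm (y n).
  by apply: le_lt_trans (hy n).2; rewrite !mulr_ge0 // exprn_ge0.
pose q n : R[i] := 3^-1 ^+ n.
have q0 n : 0 < q n by rewrite exprn_gt0 // invr_gt0.
pose v n : H := (q n / hnorm (y n)) *: y n.
have hv n : hnorm (v n) = q n.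
  by rewrite hnorm_scale gtr0_norm ?divr_gt0 // divfK ?gt_eqF.
pose good n x := q n * hnorm (y n) <= `|inner (y n) x : A|.
pose x := fix x n := if n is m.+1 then
  if good m (x m + v m) then x m + v m else x m - v m else 0.
have x_step n : hnorm (x n.+1 - x n) <= 1 * q n.
  rewrite mul1r /=; case: ifP => _; first by rewrite addrAC subrr add0r hv.
  by rewrite addrAC subrr add0r hnorm_opp hv.
have Fx n : F (x n).
  elim: n => [|n IH]; first exact: csub0.
  have Fv : F (v n) by apply: csubZ => //; apply: SF; exact: (hy n).1.
  by rewrite /=; case: ifP => _; [apply: csubD | apply: csubB].
have x_good n : good n (x n.+1).
  rewrite /=; case: ifPn => // bad.
  have qy : 0 <= q n * hnorm (y n) by rewrite mulr_ge0 ?hnorm_ge0 // ltW.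
  move: bad; rewrite /good -real_ltNge ?ger0_real // => bad.
  have sum : q n * hnorm (y n) *+ 2 <= `|inner (y n) (x n + v n) : A|
      + `|inner (y n) (x n - v n) : A|.
    apply: le_trans (ler_normB _ _).
    rewrite -innerNr -innerDr opprB [x n + _]addrC addrACA subrr addr0 -mulr2n.
    have -> : v n *+ 2 = (2 * (q n / hnorm (y n))) *: y n.
      by rewrite -scaler_nat scalerA.
    rewrite innerZr normrZ -hnorm_sqr gtr0_norm ?mulr_gt0 ?invr_gt0 //.
    move: (q n) (hnorm (y n)) (y0 n) => s t /gt_eqF/negbT t0.
    by rewrite le_eqVlt; apply/orP; left; apply/eqP; field.
  (* [x n + v n] fails and the two values add up to at least twice the bound. *)
  rewrite -(lerD2l (`|inner (y n) (x n + v n) : A|)).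
  apply: le_trans sum; rewrite mulr2n lerD2r; exact: ltW.
have [l hl] := geometric_cvg ler01 x_step.
have Fl : F l by apply: (geometric_csub cF _ hl) => //; rewrite mulr1 divr_ge0.
have [c hc] := pb l Fl.
have c0 : 0 <= c by apply: le_trans (hc (y 0%N) (hy 0%N).1).
have [n cn] := complex_nat_bound c0.
suff : n%:R <= `|inner (y n) l : A|.
  move=> nl; have := le_trans nl (hc _ (hy n).1).
  by move=> /(lt_le_trans cn); rewrite ltxx.
have small : `|inner (y n) (x n.+1 - l) : A| <= q n * hnorm (y n) / 2.
  apply: le_trans (cauchy_schwarz _ _) _.
  apply: le_trans (ler_wpM2l (hnorm_ge0 _) (hl n.+1)) _.
  rewrite exprS -/(q n); move: (q n) (hnorm _) => s t.
  by rewrite le_eqVlt; apply/orP; left; apply/eqP; field; rewrite ?pnatr_eq0.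
have : q n * hnorm (y n) / 2 <= `|inner (y n) l : A|.
  rewrite -(lerD2l (q n * hnorm (y n) / 2)) -splitr.
  apply: le_trans (x_good n) _.
  have -> : inner (y n) (x n.+1) = inner (y n) (x n.+1 - l) + inner (y n) l :> A.
    by rewrite -innerDr subrK.
  apply: le_trans (ler_normD _ _) _; exact: lerD.
apply: le_trans; rewrite ler_pdivlMr // mulrC.
rewrite /q exprVn [_^-1 * _]mulrC ler_pdivlMr ?exprn_gt0 //; exact/ltW/(hy n).2.
Qed.

End Limits.
(** * Bounded self-adjoint operators that are bounded below *)

Section OpLinear.
Context (R : realType) (A : cstarType R) (H K : innerModType A).
Implicit Types T : 'L(H, K).

Lemma opZ T (c : R[i]) x : T (c *: x) = c *: T x.
Proof. by apply: inner_injl => z; rewrite innerZl !opP innerZl. Qed.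

Lemma opN T x : T (- x) = - T x.
Proof. by rewrite -scaleN1r opZ scaleN1r. Qed.

Lemma opB T x y : T (x - y) = T x - T y.
Proof. by rewrite opD opN. Qed.

Lemma op0 T : T 0 = 0.
Proof. by rewrite -[X in T X](subrr 0) opB subrr. Qed.

Lemma adjP T x y : inner (adj T y) x = inner y (T x) :> A.
Proof. exact: opP. Qed.

End OpLinear.

Section Bounded.
Context (R : realType) (A : cstarType R) (H K : hilbertModType A).

(** The vectors [T x] with [|x| <= 1] are bounded pointwise as functionals, since
    [<T x, z> = <x, T^* z>]. *)
Lemma adjointable_bounded (T : 'L(H, K)) :
  exists2 M : R[i], 0 <= M & forall x, hnorm (T x) <= M * hnorm x.
Proof.
have [||M M0 hM] := @uniform_boundedness _ _ _ (fun=> True)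
    (fun z : K => exists2 x, hnorm x <= 1 & z = T x) (@closed_submoduleT _ _ K).
- by [].
- move=> z _; exists (hnorm (adj T z)) => _ [x x1 ->]; rewrite opP.
  apply: le_trans (cauchy_schwarz _ _) _.
  by rewrite ler_piMl ?hnorm_ge0.
exists M => // x; have [x0|x0] := eqVneq (hnorm x) 0.
  by rewrite (hnorm_eq0 x0) op0 !hnorm0 mulr0.
have xp : 0 < hnorm x by rewrite lt_def x0 hnorm_ge0.
rewrite -ler_pdivrMr // mulrC -[X in X * _]ger0_norm ?invr_ge0 ?hnorm_ge0 //.
rewrite -hnorm_scale; apply: hM; exists ((hnorm x)^-1 *: x); last by rewrite opZ.
by rewrite hnorm_scale ger0_norm ?invr_ge0 ?hnorm_ge0 // mulVf.
Qed.

End Bounded.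

Section Surjectivity.
Context (R : realType) (A : cstarType R) (H : hilbertModType A).
Variable F : H -> Prop.
Hypothesis cF : closed_submodule F.
Implicit Types (b d : H -> H) (x y z f : H) (c e : R[i]).

Definition selfadjoint_map b := forall x y, inner (b x) y = inner x (b y) :> A.
Definition onto b := forall f, F f -> exists2 y, F y & b y = f.
Definition below c b := forall y, F y -> hnorm y <= c * hnorm (b y).

Lemma symB b x y : selfadjoint_map b -> b (x - y) = b x - b y.
Proof.
move=> sb; apply: inner_injl => z.
by rewrite sb !innerDl !innerNl !sb.
Qed.

(** The iteration [b y_{n+1} = f + d y_n] contracts by the factor 1/3.
    Symmetry of [b] makes its graph closed, so that the limit solves the
    equation. *)
Lemma onto_perturb b d c : selfadjoint_map b -> selfadjoint_map d ->
  (forall x, F x -> F (d x)) -> 0 <= c -> below c b ->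
  (forall x, F x -> c * hnorm (d x) <= 3^-1 * hnorm x) ->
  onto b -> onto (fun x => b x - d x).
Proof.
move=> sb sd Fd c0 cb small ob f Ff.
have /choice[g hg] : forall x, exists y, F x -> F y /\ b y = f + d x.
  move=> x; have [Fx|nFx] := pselect (F x); last by exists 0.
  by have [|y Fy yE] := ob (f + d x); [apply: csubD => //; exact: Fd|exists y].
pose u n := iter n g 0.
have Fu n : F (u n) by elim: n => [|n IH]; [exact: csub0|exact: (hg _ IH).1].
have bu n : b (u n.+1) = f + d (u n) := (hg _ (Fu n)).2.
have u_step n : hnorm (u n.+1 - u n) <= hnorm (u 1%N) * 3^-1 ^+ n.
  elim: n => [|n IH]; first by rewrite subr0 mulr1.
  have Fdu m : F (u m.+1 - u m) by exact: csubB.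
  apply: le_trans (cb _ (Fdu _)) _.
  rewrite symB // !bu opprD addrACA subrr add0r -symB //.
  apply: le_trans (small _ (Fdu _)) _.
  by rewrite exprS mulrCA ler_wpM2l ?invr_ge0.
have C0 : 0 <= hnorm (u 1%N) by exact: hnorm_ge0.
have [l hl] := geometric_cvg C0 u_step.
set C := 3 / 2 * _ in hl; have C0' : 0 <= C by rewrite mulr_ge0 // divr_ge0.
exists l; first exact: geometric_csub cF C0' hl Fu.
apply: inner_injl => z; apply/eqP; rewrite -subr_eq0 -normr_le0.
apply/ler_addgt0Pr => e e0; rewrite add0r.
have D0 : 0 <= C * (hnorm (b z) + hnorm (d z)).
  by rewrite mulr_ge0 // addr_ge0 ?hnorm_ge0.
have [N hN] := geometric_small D0 e0; have {hN} := hN N (leqnn N).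
move=> /ltW; apply: le_trans.
have -> : inner (b l - d l) z - inner f z
    = inner (l - u N.+1) (b z) - inner (l - u N) (d z) :> A.
  have -> : inner f z = inner (u N.+1) (b z) - inner (u N) (d z) :> A.
    by rewrite -sb -sd bu innerDl addrK.
  have zmod (V : zmodType) (p q r t : V) : p - q - (r - t) = p - r - (q - t).
    by rewrite !opprB addrACA [RHS]addrACA [- q - r]addrC.
  by rewrite !innerDl !innerNl sb sd zmod.
apply: le_trans (ler_normB _ _) _.
rewrite mulrDr mulrDl; apply: lerD.
  apply: le_trans (cauchy_schwarz _ _) _.
  rewrite mulrAC ler_wpM2r ?hnorm_ge0 // hdistC; apply: le_trans (hl _) _.
  rewrite ler_wpM2l // exprS ler_piMl ?exprn_ge0 ?invr_ge0 //.
  by rewrite invf_le1 // ler1n.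
apply: le_trans (cauchy_schwarz _ _) _.
by rewrite mulrAC ler_wpM2r ?hnorm_ge0 // hdistC.
Qed.

Variable a : 'L(H).
Hypothesis a_sym : selfadjoint_map a.
Hypothesis a_pos : forall x, cpos (inner (a x) x : A).
Hypothesis Fa : forall x, F x -> F (a x).

Let shift e x := a x + e *: x.

Let shift_sym e : 0 <= e -> selfadjoint_map (shift e).
Proof.
move=> e0 x y; rewrite /shift innerDl innerDr a_sym innerZl innerZr.
by rewrite geC0_conj.
Qed.

Let shift_norm e x : 0 < e -> hnorm (a x) <= hnorm (shift e x).
Proof.
move=> e0; apply: (hnorm_mono (p := e *: (inner (a x) x + inner (a x) x)
    + e *: (e *: inner x x))).
- apply: cposD; apply: cposZ => //; first exact: cposD.
  by apply: cposZ => //; exact: inner_ge0.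
- exact: inner_ge0.
rewrite /shift innerDl !innerDr !innerZl !innerZr geC0_conj ?ltW // -addrA.
by congr (_ + _); rewrite scalerDr -a_sym addrA.
Qed.

(** [a + e] is onto for large [e]. Since [a + e] is bounded below by the same
    constant for all [e >= 0], the parameter [e] can then be brought down to 0
    in steps of fixed size. *)
Lemma pos_below_onto c : 0 <= c -> below c a -> onto a.
Proof.
move=> c0 ca; have [M M0 aM] := adjointable_bounded a.
(* [|a| <= E / 3], so that [a] is a small perturbation of [E]. *)
pose E : R[i] := 3 * M + 1; have E0 : 0 < E by rewrite ltr_wpDl // mulr_ge0.
have oE : onto (shift E).
  have opp_sym : selfadjoint_map (fun x => - a x).
    by move=> x y; rewrite innerNl innerNr a_sym.
  have := @onto_perturb (fun x => E *: x) (fun x => - a x) E^-1 _ opp_sym.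
  have -> : (fun x => E *: x - - a x) = shift E.
    by apply/funext => x; rewrite opprK addrC.
  apply.
  - by move=> x y; rewrite innerZl innerZr geC0_conj // ltW.
  - by move=> x Fx; rewrite -scaleN1r; apply: csubZ => //; exact: Fa.
  - by rewrite invr_ge0 ltW.
  - by move=> y _; rewrite hnorm_scale gtr0_norm // mulKf ?gt_eqF.
  - move=> x _; rewrite hnorm_opp mulrC ler_pdivrMr //.
    apply: le_trans (aM x) _; rewrite mulrAC ler_wpM2r ?hnorm_ge0 //.
    by rewrite /E mulrDr mulKf ?pnatr_eq0 // lerDl mulr1 invr_ge0.
  - move=> f Ff; exists (E^-1 *: f); first exact: csubZ.
    by rewrite scalerA divff ?scale1r // gt_eqF.
(* The step [E / n] must be at most [1 / (3 c)]. *)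
have [n hn] : exists n, 3 * c * E < n%:R.
  by apply: complex_nat_bound; rewrite !mulr_ge0 // ltW.
have n0 : 0 < n%:R :> R[i] by apply: le_lt_trans hn; rewrite !mulr_ge0 // ltW.
pose s : R[i] := E / n%:R; have s0 : 0 < s by rewrite divr_gt0.
have down k : onto (shift (k.+1%:R * s)) -> onto (shift (k%:R * s)).
  move=> ok; have kp : 0 < k.+1%:R * s by rewrite mulr_gt0.
  have s_sym : selfadjoint_map (fun x => s *: x).
    by move=> x y; rewrite innerZl innerZr geC0_conj // ltW.
  have := @onto_perturb (shift (k.+1%:R * s)) (fun x => s *: x) c _ s_sym.
  have -> : (fun x => shift (k.+1%:R * s) x - s *: x) = shift (k%:R * s).
    apply/funext => x; rewrite /shift -addrA -scalerBl -natr1 mulrDl mul1r.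
    by rewrite addrK.
  apply=> //; first exact/shift_sym/ltW.
  - by move=> x Fx; exact: csubZ.
  - move=> y Fy; apply: le_trans (ca y Fy) _.
    by rewrite ler_wpM2l // shift_norm.
  - move=> x _; rewrite hnorm_scale gtr0_norm // mulrA ler_wpM2r ?hnorm_ge0 //.
    rewrite /s mulrA ler_pdivrMr // ler_pdivlMl // mulrA.
    exact: ltW.
suff : onto (shift (0%:R * s)).
  by rewrite mul0r => h f /h[y Fy <-]; exists y; rewrite // /shift scale0r addr0.
have {}down k : onto (shift (k%:R * s)) -> onto (shift (0%:R * s)).
  by elim: k => [//|k IH] /down.
by apply: (down n); rewrite /s mulrC divfK // gt_eqF.
Qed.

End Surjectivity.
(** * Existence of Moore-Penrose inverses and of inverses *)

Section OpAlgebra.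
Context (R : realType) (A : cstarType R).
Implicit Types H K L P : innerModType A.

Lemma ocompA H K L P (S : 'L(L, P)) (T : 'L(K, L)) (U : 'L(H, K)) :
  S *o (T *o U) = S *o T *o U.
Proof. exact: adjointable_eq. Qed.

Lemma comp1o H K (T : 'L(H, K)) : opid K *o T = T.
Proof. exact: adjointable_eq. Qed.

Lemma compo1 H K (T : 'L(H, K)) : T *o opid H = T.
Proof. exact: adjointable_eq. Qed.

Lemma comp0o H K L (T : 'L(H, K)) : (0 : 'L(K, L)) *o T = 0.
Proof. exact: adjointable_eq. Qed.

Lemma compo0 H K L (S : 'L(K, L)) : S *o (0 : 'L(H, K)) = 0.
Proof. by apply: adjointable_eq => x; exact: op0. Qed.

Lemma compDl H K L (S S' : 'L(K, L)) (T : 'L(H, K)) :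
  (S + S') *o T = S *o T + S' *o T.
Proof. exact: adjointable_eq. Qed.

Lemma compBl H K L (S S' : 'L(K, L)) (T : 'L(H, K)) :
  (S - S') *o T = S *o T - S' *o T.
Proof. exact: adjointable_eq. Qed.

Lemma compDr H K L (S : 'L(K, L)) (T T' : 'L(H, K)) :
  S *o (T + T') = S *o T + S *o T'.
Proof. by apply: adjointable_eq => x; exact: opD. Qed.

Lemma compNr H K L (S : 'L(K, L)) (T : 'L(H, K)) : S *o - T = - (S *o T).
Proof. by apply: adjointable_eq => x; exact: opN. Qed.

Lemma compBr H K L (S : 'L(K, L)) (T T' : 'L(H, K)) :
  S *o (T - T') = S *o T - S *o T'.
Proof. by rewrite compDr compNr. Qed.

Lemma oadjK H K (T : 'L(H, K)) : T^*^* = T.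
Proof. exact: adjointable_eq. Qed.

Lemma oadj_comp H K L (S : 'L(K, L)) (T : 'L(H, K)) :
  (S *o T)^* = T^* *o S^*.
Proof. exact: adjointable_eq. Qed.

Lemma oadjD H K (S T : 'L(H, K)) : adj (S + T) = adj S + adj T.
Proof. exact: adjointable_eq. Qed.

Lemma oadjB H K (S T : 'L(H, K)) : adj (S - T) = adj S - adj T.
Proof. exact: adjointable_eq. Qed.

Lemma oadj0 H K : adj (0 : 'L(H, K)) = 0.
Proof. exact: adjointable_eq. Qed.

Lemma oadj1 H : (opid H)^* = opid H.
Proof. exact: adjointable_eq. Qed.

Lemma oadj_gram H K (T : 'L(H, K)) : (T^* *o T)^* = T^* *o T.
Proof. by rewrite oadj_comp oadjK. Qed.

Definition is_mpinv H K (T : 'L(H, K)) (X : 'L(K, H)) : Prop :=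
  [/\ T *o X *o T = T, X *o T *o X = X, (T *o X)^* = T *o X
    & (X *o T)^* = X *o T].

Lemma is_wmpinv_id H K (T : 'L(H, K)) X :
  is_wmpinv (opid K) (opid H) T X <-> is_mpinv T X.
Proof. by rewrite /is_wmpinv !comp1o. Qed.

Lemma mpinv_unique H K (T : 'L(H, K)) X Y :
  is_mpinv T X -> is_mpinv T Y -> X = Y.
Proof.
move=> [TXT XTX TXs XTs] [TYT YTY TYs YTs].
have TXY : T *o X = T *o Y.
  transitivity (T *o X *o (T *o Y)); last by rewrite ocompA TXT.
  by rewrite -[X in _ = X *o _]TXs -[X in _ = _ *o X]TYs -oadj_comp ocompA TYT TXs.
have XYT : X *o T = Y *o T.
  transitivity (Y *o T *o (X *o T)); last by rewrite -ocompA (ocompA T) TXT.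
  rewrite -[X in _ = X *o _]YTs -[X in _ = _ *o X]XTs -oadj_comp -(ocompA X).
  by rewrite (ocompA T) TYT XTs.
by rewrite -XTX XYT -ocompA TXY ocompA YTY.
Qed.

Lemma mpinv_adj H K (T : 'L(H, K)) X : is_mpinv T X -> is_mpinv T^* X^*.
Proof.
move=> [TXT XTX TXs XTs]; split.
- by rewrite -!oadj_comp ocompA TXT.
- by rewrite -!oadj_comp ocompA XTX.
- by rewrite -oadj_comp XTs.
- by rewrite -oadj_comp TXs.
Qed.

Lemma mpinv_gram H K (T : 'L(H, K)) X : is_mpinv T X ->
  is_mpinv (T *o T^*) (X^* *o X).
Proof.
move=> [TXT XTX TXs XTs].
have e1 : T *o T^* *o (X^* *o X) = T *o X.
  by rewrite ocompA -(ocompA T) -oadj_comp XTs ocompA TXT.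
have e2 : X^* *o X *o (T *o T^*) = T *o X.
  by rewrite ocompA -(ocompA _ X) -XTs -!oadj_comp XTX TXs.
split; rewrite ?e1 ?e2 ?TXs //.
- by rewrite ocompA TXT.
- by rewrite ocompA -TXs -oadj_comp ocompA XTX.
Qed.

End OpAlgebra.

Section MPInverse.
Context (R : realType) (A : cstarType R).
Implicit Types H K L : hilbertModType A.

Lemma gram_eq0 K (H : innerModType A) (T : 'L(H, K)) x : T^* (T x) = 0 -> T x = 0.
Proof. by move=> h; apply: inner_eq0; rewrite -adjP h inner0l. Qed.

Lemma gram_comp_eq0 K (H L : innerModType A) (W : 'L(H, K)) (U : 'L(L, H)) :
  W^* *o W *o U = 0 -> W *o U = 0.
Proof.
move=> h; apply: adjointable_eq => x /=; apply: gram_eq0.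
exact: (congr1 (fun V : 'L(L, H) => V x) h).
Qed.

Lemma positive_definite_id K : positive_definite (opid K).
Proof.
split=> [x|]; first exact: inner_ge0.
by exists (opid K); split; exact: adjointable_eq.
Qed.

Lemma wmpinvP H K (M : 'L(K)) (N : 'L(H)) (T : 'L(H, K)) :
  positive_definite M -> positive_definite N -> (exists X, is_wmpinv M N T X) ->
  is_wmpinv M N T (wmpinv M N T).
Proof.
move=> pM pN [X TX]; rewrite /wmpinv.
by case: xgetP => [Y _ []|] // /(_ X) []; split.
Qed.

Lemma mpinvP H K (T : 'L(H, K)) X : is_mpinv T X -> mpinv T = X.
Proof.
move=> TX; apply: (@mpinv_unique _ _ _ _ T) => //; apply/is_wmpinv_id.
apply: wmpinvP; [exact: positive_definite_id..|].
by exists X; apply/is_wmpinv_id.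
Qed.

Section ClosedRange.
Variables (H K : hilbertModType A) (T : 'L(H, K)).
Hypothesis cT : closed_range T.

Let F y := exists x, T x = y.

Let cF : closed_submodule F.
Proof.
split.
- by exists 0; exact: op0.
- by move=> _ _ [x <-] [y <-]; exists (x + y); exact: opD.
- by move=> c _ [x <-]; exists (c *: x); exact: opZ.
- by move=> y hy; apply: cT => e /hy[_ [x <-] xy]; exists x.
Qed.

Let a : 'L(K) := T *o T^*.
Let a_sym : selfadjoint_map a.
Proof. by move=> x y; rewrite opP. Qed.

(** The elements [y] of the range with [|T^* y| <= 1] are bounded pointwise as
    functionals on the range, since [<y, T x> = <T^* y, x>]. *)
Lemma adj_below_on_range : exists2 c : R[i], 0 <= c &
  forall y, F y -> hnorm y <= c * hnorm (T^* y).
Proof.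
have [||c c0 hc] := @uniform_boundedness _ _ _ F
    (fun y => F y /\ hnorm (T^* y) <= 1) cF.
- by move=> y [].
- move=> _ [x <-]; exists (hnorm x) => y [_ y1]; rewrite -adjP.
  apply: le_trans (cauchy_schwarz _ _) _.
  by rewrite ler_piMl ?hnorm_ge0.
exists c => // y Fy; have [y0|y0] := eqVneq (hnorm (T^* y)) 0.
  rewrite y0 mulr0; suff -> : y = 0 by rewrite hnorm0.
  have [x Tx] := Fy; apply: inner_eq0.
  by rewrite -{2}Tx -adjP (hnorm_eq0 y0) inner0l.
have yp : 0 < hnorm (T^* y) by rewrite lt_def y0 hnorm_ge0.
rewrite -ler_pdivrMr // mulrC -[X in X * _]gtr0_norm ?invr_gt0 //.
rewrite -hnorm_scale; apply: hc; split; first exact: csubZ.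
by rewrite opZ hnorm_scale gtr0_norm ?invr_gt0 // mulVf.
Qed.

Let a_below : exists2 c : R[i], 0 <= c & below F c a.
Proof.
have [c c0 hc] := adj_below_on_range.
exists (c ^+ 2); first exact: exprn_ge0.
move=> y Fy; have [y0|y0] := eqVneq (hnorm y) 0.
  by rewrite y0 mulr_ge0 ?hnorm_ge0 // exprn_ge0.
have yp : 0 < hnorm y by rewrite lt_def y0 hnorm_ge0.
rewrite -(ler_pM2r yp) -expr2 -mulrA.
apply: le_trans (_ : c ^+ 2 * hnorm (T^* y) ^+ 2 <= _).
  by rewrite -exprMn ler_pXn2r ?nnegrE ?mulr_ge0 ?hnorm_ge0 // hc.
rewrite ler_wpM2l ?exprn_ge0 // hnorm_sqr adjP.
by rewrite mulrC; exact: cauchy_schwarz.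
Qed.

Let a_onto : onto F a.
Proof.
have [c c0 ca] := a_below; apply: (pos_below_onto cF a_sym _ _ c0 ca).
- by move=> x; rewrite -[a x]/(T (T^* x)) opP; exact: inner_ge0.
- by move=> x _; exists (T^* x).
Qed.

Let a_inj x y : F x -> F y -> a x = a y -> x = y.
Proof.
move=> Fx Fy axy; have [c _ ca] := a_below.
apply/eqP; rewrite -subr_eq0; apply/eqP/hnorm_eq0/eqP.
rewrite eq_le hnorm_ge0 andbT; apply: le_trans (ca _ (csubB cF Fx Fy)) _.
by rewrite opB axy subrr hnorm0 mulr0.
Qed.

(** With [a = T T^*] inverted on the range of [T], the inverse is
    [X = T^* a^-2 T T^*] and its adjoint is [a^-1 T]. *)
Lemma closed_range_mpinv : exists X, is_mpinv T X.
Proof.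
have FT x : F (T x) by exists x.
have Fa x : F (a x) by exact: FT.
have /choice[w hw] : forall y, exists w, F w /\ a w = a y.
  by move=> y; have [w Fw wE] := a_onto (Fa y); exists w.
have Fw y := (hw y).1; have aw y : a (w y) = a y := (hw y).2.
have w_id y : F y -> w y = y by move=> Fy; exact: a_inj.
have w_inner y z : F z -> inner (w y) z = inner y z :> A.
  move=> [x <-]. rewrite -!(adjP T); congr inner.
  apply/eqP; rewrite -subr_eq0 -opB; apply/eqP.
  have := @gram_eq0 _ _ T^* (w y - y); apply.
  by rewrite -[LHS]/(a (w y - y)) opB aw subrr.
have /choice[v hv] : forall y, exists v, F v /\ a v = w y.
  by move=> y; have [v Fv vE] := a_onto (Fw y); exists v.
have Fv y := (hv y).1; have av y : a (v y) = w y := (hv y).2.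
have XP y x : inner (T^* (v y)) x = inner y (v (T x)) :> A.
  rewrite adjP -[X in inner _ X = _](w_id _ (FT x)) -av -a_sym av.
  exact: w_inner.
exists (Adjointable XP); have TX y : T (T^* (v y)) = w y := av y.
split; apply: adjointable_eq => x /=.
- by rewrite TX w_id.
- rewrite TX; congr (opadj T _); apply: a_inj => //.
  by rewrite !av w_id.
- have -> : T (opadj T (v x)) = w x := TX x.
  by apply: a_inj => //; rewrite av aw w_id.
- by [].
Qed.

End ClosedRange.
(** [1 + C^* C] is bounded below by 1, since [<y + C^* C y, y + C^* C y>] is the sum
    of [<y, y>] and of positive elements. *)
Lemma one_plus_gram_onto H K (C : 'L(H, K)) :
  onto (fun=> True) (opid H + C^* *o C).
Proof.
apply: (pos_below_onto (@closed_submoduleT _ _ H) _ _ _ ler01) => //.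
- move=> x y; rewrite opP; congr inner.
- move=> x; rewrite innerDl; apply: cposD; first exact: inner_ge0.
  by rewrite adjP; exact: inner_ge0.
- move=> y _; rewrite mul1r.
  apply: (hnorm_mono (p := (inner (C y) (C y) + inner (C y) (C y))
    + inner (C^* (C y)) (C^* (C y)))); last 1 first.
  + have e : inner (C^* (C y)) y = inner (C y) (C y) :> A by exact: adjP.
    have e' : inner y (C^* (C y)) = inner (C y) (C y) :> A.
      by rewrite inner_star e -inner_star.
    rewrite -[(opid H + _) y]/(y + adj C (C y)) innerDl !innerDr e e'.
    by rewrite !addrA.
  + by apply: cposD; [apply: cposD|]; exact: inner_ge0.
  + exact: inner_ge0.
Qed.

Lemma one_plus_gram_inv H K (C : 'L(H, K)) :
  exists N, is_opinv (opid H + C^* *o C) N.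
Proof.
have /choice[g hg] : forall x, exists y, (opid H + C^* *o C) y = x.
  by move=> x; have [|y _ yE] := @one_plus_gram_onto _ _ C x; [|exists y].
have Gs x y : inner ((opid H + C^* *o C) x) y = inner x ((opid H + C^* *o C) y) :> A.
  by rewrite opP.
have gP x y : inner (g x) y = inner x (g y) :> A.
  by rewrite -{1}(hg y) -Gs hg.
exists (Adjointable gP); split; apply: adjointable_eq => x; first exact: hg.
by apply: inner_injl => z /=; rewrite gP -[RHS](congr1 (inner x) (hg z)) -Gs.
Qed.

End MPInverse.
(** * Weighted Moore-Penrose inverses *)

Section Weighted.
Context (R : realType) (A : cstarType R).

Lemma comp_pre (H K L P : innerModType A) (S : 'L(K, L)) (T : 'L(H, K)) U :
  S *o T = U -> forall V : 'L(L, P), V *o S *o T = V *o U.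
Proof. by move=> <- V; rewrite ocompA. Qed.

Lemma opinv_selfadj (K : innerModType A) (G N : 'L(K)) :
  G^* = G -> is_opinv G N -> N^* = N.
Proof.
move=> Gs [GN NG]; have NsG : N^* *o G = opid K.
  by rewrite -[X in _ *o X]Gs -oadj_comp GN oadj1.
by rewrite -[N^*]compo1 -GN ocompA NsG comp1o.
Qed.

Lemma opinvP (K : innerModType A) (G N : 'L(K)) :
  is_opinv G N -> is_opinv G (opinv G).
Proof. by move=> GN; apply: (xgetI 0 GN). Qed.

Variables (K K' : hilbertModType A) (B : 'L(K, K')) (N : 'L(K)).
Let G := opid K + B^* *o B.
Hypothesis GN : is_opinv G N.

Lemma one_plus_gram_selfadj : G^* = G.
Proof. by rewrite oadjD oadj1 oadj_gram. Qed.

Let Gs := one_plus_gram_selfadj.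
Let Ns : N^* = N := opinv_selfadj Gs GN.

Lemma one_plus_gram_posdef : positive_definite G.
Proof.
split=> [x|]; last by exists N.
rewrite -[G x]/(x + adj B (B x)) innerDl adjP.
by apply: cposD; exact: inner_ge0.
Qed.

Lemma one_plus_gram_inv_posdef : positive_definite N.
Proof.
case: GN => GN1 NG1; split=> [x|]; last by exists G.
rewrite -{2}[x]/(opid K x) -GN1 /= -[X in inner _ X]/(G (N x)).
by rewrite -{1}Gs -[X in inner X _]/(N x) -adjP Gs; apply: one_plus_gram_posdef.1.
Qed.

(** Let [p] be the projection onto the kernel of [S]. The compression of [G] to
    the range of [p] is invertible, because [p G p + 1 - p = 1 + (B p)^* (B p)]. Its
    inverse [J] gives the idempotent [Q = 1 - p J p G], which has the same kernel
    as [S] and is self-adjoint for the weight [G]. Then [X = Q Sd Q^*] satisfies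
    [X S = Q] and [S X = Q^*]. *)
Lemma weighted_mpinv (S Sd : 'L(K)) : S^* = S -> is_mpinv S Sd ->
  exists X, is_wmpinv N G S X.
Proof.
move=> Ss SSd; have [S1 S2 S3 S4] := SSd.
have Sds : Sd^* = Sd.
  by apply: mpinv_unique SSd; rewrite -[S in is_mpinv S]Ss; exact: mpinv_adj.
have SSdC : Sd *o S = S *o Sd by rewrite -S4 oadj_comp Ss Sds.
have [p pE] : exists p, Sd *o S = opid K - p.
  by exists (opid K - Sd *o S); rewrite subKr.
have pE' : p = opid K - Sd *o S by rewrite pE subKr.
have ps : p^* = p by rewrite pE' oadjB oadj1 S4.
have Sp : S *o p = 0 by rewrite pE' compBr compo1 ocompA S1 subrr.
have pp : p *o p = p.
  by rewrite {1}pE' compBl comp1o -ocompA Sp compo0 subr0.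
have [J] := one_plus_gram_inv (B *o p).
have -> : opid K + (B *o p)^* *o (B *o p) = opid K + p *o (B^* *o B) *o p.
  by rewrite oadj_comp ps !ocompA.
have [M ME] : exists M, M = B^* *o B by eexists.
have Ms : M^* = M by rewrite ME oadj_gram.
rewrite -ME; set V := opid K + _ => VJ; have [VJ1 JV1] := VJ.
have Js : J^* = J.
  apply: opinv_selfadj VJ.
  by rewrite oadjD oadj1 !oadj_comp Ms ps ocompA.
have Vp : V *o p = p *o G *o p.
  by rewrite compDl comp1o (comp_pre pp) /G -ME compDr compDl compo1 pp.
have pV : p *o V = V *o p.
  by rewrite compDr compDl comp1o compo1 !ocompA pp (comp_pre pp).
clearbody V.
have pJ : p *o J = J *o p.
  by rewrite -[p in LHS]comp1o -JV1 -(ocompA J) -pV ocompA -ocompA VJ1 compo1.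
have [Q QE] : exists Q, Q = opid K - p *o J *o p *o G by eexists.
have Qp : Q *o p = 0.
  rewrite QE compBl comp1o -!ocompA [p *o (G *o p)]ocompA -Vp.
  by rewrite [J *o _]ocompA JV1 comp1o pp subrr.
have QQ : Q *o Q = Q.
  by rewrite {2}QE compBr compo1 !ocompA Qp !comp0o subr0.
have SQ : S *o Q = S by rewrite QE compBr compo1 !ocompA Sp !comp0o subr0.
have GQs : (G *o Q)^* = G *o Q.
  by rewrite QE compBr compo1 oadjB !oadj_comp Gs ps Js !ocompA.
have QsS : Q^* *o S = S by rewrite -{1}Ss -oadj_comp SQ.
have QP : Q *o (Sd *o S) = Q by rewrite pE compBr compo1 Qp subr0.
pose X : 'L(K) := Q *o Sd *o Q^*.
have XS : X *o S = Q by rewrite -ocompA QsS -ocompA QP.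
have SX : S *o X = Q^*.
  by rewrite !ocompA SQ -SSdC -[in LHS]S4 -oadj_comp QP.
exists X; split.
- by rewrite SX.
- by rewrite XS !ocompA QQ.
- rewrite -ocompA SX oadj_comp oadjK Ns.
  have GQ : Q^* *o G = G *o Q by rewrite -GQs oadj_comp Gs.
  case: GN => GN1 NG1.
  by rewrite -[LHS]comp1o -NG1 -[N *o Q^* in RHS]compo1 -GN1 -!ocompA
    [Q^* *o (G *o _)]ocompA GQ !ocompA.
- by rewrite -ocompA XS.
Qed.

End Weighted.
(** * Verification of the formula *)

Section Penrose.
Context (R : realType) (A : cstarType R).
Variables (H K K2 : hilbertModType A).
Variables (T : 'L(H, K)) (F e2 : 'L(K2, K)) (E Z0 Q : 'L(K)).
Variables (S G N X D : 'L(K2)).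
Hypothesis TT : T *o T^* = E.
Hypothesis FF : F^* *o F = G.
Hypothesis DE : D = opid K2 - S *o X.
Hypothesis GN : is_opinv G N.
Hypothesis S_wmp : is_wmpinv N G S X.
Hypothesis EF : E *o F = e2 *o S.
Hypothesis Fe2 : F^* *o e2 = opid K2.
Hypothesis EZ0 : E *o Z0 = opid K - Q - e2 *o F^*.
Hypothesis Z0s : Z0^* = Z0.
Hypothesis Qs : Q^* = Q.
Hypothesis QF : Q *o F = 0.
Hypothesis QT : Q *o T = 0.
Hypothesis Z0Q : Z0 *o Q = 0.

(** Let [V = 1 - F N D F^*], [W = T^* F] and let [T^* Z] be the operator of the
    statement. The hypotheses give [E Z = V - Q] and
    [T^* Z T = T^* Z0 T + W X W^*], and [V - Q] fixes both [T] and [Z] (the latter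
    on the right). *)
Lemma penrose_formula : is_mpinv T
  (T^* *o (Z0 *o (opid K - F *o N *o D *o F^*) + F *o X *o F^*)).
Proof.
have [SXS XSX NSX _] := S_wmp; have [GN1 _] := GN.
have [W WE] : exists W, W = T^* *o F by eexists.
have Ws : W^* = F^* *o T by rewrite WE oadj_comp oadjK.
have WW : W^* *o W = S.
  by rewrite Ws WE ocompA -(ocompA F^*) TT -ocompA EF ocompA Fe2 comp1o.
have Gs : G^* = G by rewrite -FF oadj_gram.
have Ns : N^* = N by exact: opinv_selfadj GN.
have Ss : S^* = S by rewrite -WW oadj_gram.
have DS : D *o S = 0 by rewrite DE compBl comp1o SXS subrr.
have DD : D *o D = D by rewrite {2}DE compBr compo1 ocompA DS comp0o subr0.
have FQ : F^* *o Q = 0 by rewrite -[Q]Qs -oadj_comp QF oadj0.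
(* [D S = 0] improves to [D W^* = 0] because [S = W^* W]. *)
have DW : D *o W^* = 0.
  have : S *o D^* = 0 by rewrite -Ss -oadj_comp DS oadj0.
  by rewrite -WW => /gram_comp_eq0 WD; rewrite -[D]oadjK -oadj_comp WD oadj0.
have DFT : D *o (F^* *o T) = 0 by rewrite -Ws.
have ND : (N *o D)^* = N *o D.
  by rewrite DE compBr compo1 ocompA oadjB Ns NSX.
have [V VE] : exists V, V = opid K - F *o N *o D *o F^* by eexists.
rewrite -VE.
have Vs : V^* = V.
  rewrite VE oadjB oadj1 -(ocompA F) oadj_comp oadjK [(F *o _)^*]oadj_comp ND.
  by rewrite ocompA.
have VT : V *o T = T by rewrite VE compBl comp1o -!ocompA DFT !compo0 subr0.
have QV : Q *o V = Q.
  by rewrite VE compBr compo1 !ocompA QF !comp0o subr0.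
have FV : F^* *o V = S *o X *o F^*.
  have -> : S *o X = opid K2 - D by rewrite DE subKr.
  by rewrite VE compBr compo1 !ocompA FF GN1 comp1o compBl comp1o.
have VFND : V *o F *o N *o D = 0.
  rewrite VE !compBl comp1o -!ocompA [F^* *o (F *o _)]ocompA FF.
  by rewrite [G *o (N *o D)]ocompA GN1 comp1o DD subrr.
have VV : V *o V = V.
  by rewrite {2}VE compBr compo1 !ocompA VFND comp0o subr0.
have [Z ZE] : exists Z, Z = Z0 *o V + F *o X *o F^* by eexists.
rewrite -ZE.
have EZ : E *o Z = V - Q.
  rewrite ZE compDr !ocompA EZ0 EF !compBl comp1o QV -(ocompA e2 _ V) FV.
  by rewrite !ocompA subrK.
have ZVQ : Z *o (V - Q) = Z.
  have VQ : V *o Q = Q by rewrite -Vs -[Q]Qs -oadj_comp QV.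
  rewrite ZE compBr !compDl -!ocompA VV VQ Z0Q FQ FV !compo0 addr0 subr0.
  by rewrite (ocompA X) (ocompA X S) XSX.
have TZ : T *o (T^* *o Z) = V - Q by rewrite ocompA TT.
have ZT : T^* *o Z *o T = T^* *o Z0 *o T + W *o X *o W^*.
  by rewrite ZE -ocompA compDl -ocompA VT compDr Ws WE !ocompA.
(* [S (X - X^* ) S = 0], and both outer factors can be reduced to [W] and
   [W^*]. *)
have WXW : (W *o X *o W^*)^* = W *o X *o W^*.
  have SXsS : S *o X^* *o S = S by rewrite -[in LHS]Ss -!oadj_comp ocompA SXS Ss.
  pose Y := X - adj X.
  have SYS : S *o (Y *o S) = 0 by rewrite compBl compBr !ocompA SXS SXsS subrr.
  have WYS : W *o (Y *o S) = 0 by apply: gram_comp_eq0; rewrite WW.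
  have SYW : S *o (Y^* *o W^*) = 0.
    by rewrite -[S]Ss -!oadj_comp -ocompA WYS oadj0.
  have : W *o (Y^* *o W^*) = 0 by apply: gram_comp_eq0; rewrite WW.
  rewrite /Y oadjB oadjK compBl compBr => /eqP; rewrite subr_eq0 => /eqP WXsW.
  by rewrite !oadj_comp oadjK WXsW ocompA.
split.
- by rewrite TZ compBl VT QT subr0.
- by rewrite -ocompA TZ -ocompA ZVQ.
- by rewrite TZ oadjB Vs Qs.
- by rewrite ZT oadjD WXW !oadj_comp oadjK Z0s ocompA.
Qed.

End Penrose.
Section BlockAlgebra.
Context (R : realType) (A : cstarType R).
Implicit Types H K : innerModType A.

Lemma col_opE H K1 K2 (U : 'L(H, K1)) (V : 'L(H, K2)) :
  col_op U V = adj (fst_op K1 K2) *o U + adj (snd_op K1 K2) *o V.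
Proof.
by apply: adjointable_eq => x; congr pair; rewrite /= ?addr0 ?add0r.
Qed.

Lemma diag_opE K1 K2 (U : 'L(K1)) :
  diag_op U (0 : 'L(K2)) = (fst_op K1 K2)^* *o U *o fst_op K1 K2.
Proof.
by apply: adjointable_eq => x; congr pair; rewrite /= ?addr0.
Qed.

Section Projections.
Variables K1 K2 : innerModType A.
Local Notation f := (fst_op K1 K2).
Local Notation s := (snd_op K1 K2).

Lemma fst_fst : f *o f^* = opid K1.
Proof. by apply: adjointable_eq => x; rewrite /= ?addr0. Qed.

Lemma snd_snd : s *o s^* = opid K2.
Proof. by apply: adjointable_eq => x; rewrite /= ?add0r. Qed.

Lemma fst_snd : f *o s^* = 0.
Proof. by apply: adjointable_eq => x; rewrite /= ?addr0. Qed.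

Lemma snd_fst : s *o f^* = 0.
Proof. by apply: adjointable_eq => x; rewrite /= ?add0r. Qed.

Lemma fst_snd_id : adj f *o f + adj s *o s = opid _.
Proof.
by apply: adjointable_eq => -[x y]; congr pair; rewrite /= ?addr0 ?add0r.
Qed.

End Projections.

Lemma fst_col H K1 K2 (U : 'L(H, K1)) (V : 'L(H, K2)) :
  fst_op K1 K2 *o col_op U V = U.
Proof. by apply: adjointable_eq => x; rewrite /= ?addr0. Qed.

Lemma snd_col H K1 K2 (U : 'L(H, K1)) (V : 'L(H, K2)) :
  snd_op K1 K2 *o col_op U V = V.
Proof. by apply: adjointable_eq => x; rewrite /= ?add0r. Qed.

End BlockAlgebra.

Section SchurFormula.
Context (R : realType) (A : cstarType R).
Variables (H K1 K2 : hilbertModType A) (R1 : 'L(H, K1)) (R2 : 'L(H, K2)).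
Let T : 'L(H, (K1 * K2)%type) := col_op R1 R2.
Let E := T *o T^*.

(** The formula for a column [T] of two operators: [D], [P = E11 D] and [B = D E12]
    are expressed by the rows [R1], [R2], and [penrose_formula] is applied with
    [Z0 = diag (D, 0)] and [Q = diag (1 - P, 0)]. *)
Lemma mpinv_col : closed_range R1 -> closed_range (schur E) ->
  mpinv T = T^* *o (diag_op (mpinv (ul_op E)) 0 *o XR E
                    + F1 E *o schur_g E *o (F1 E)^*).
Proof.
move=> cR1 cS; apply: mpinvP.
have [f fE] : exists f, f = fst_op K1 K2 by eexists.
have [s sE] : exists s, s = snd_op K1 K2 by eexists.
have ff : f *o f^* = opid K1 by rewrite fE fst_fst.
have ss : s *o s^* = opid K2 by rewrite sE snd_snd.
have fs : f *o s^* = 0 by rewrite fE sE fst_snd.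
have sf : s *o f^* = 0 by rewrite fE sE snd_fst.
have fT : f *o T = R1 by rewrite fE; exact: fst_col.
have sT : s *o T = R2 by rewrite sE; exact: snd_col.
have TE : T = adj f *o R1 + adj s *o R2 by rewrite fE sE; exact: col_opE.
have Tf : T^* *o f^* = R1^* by rewrite -oadj_comp fT.
have Ts : T^* *o s^* = R2^* by rewrite -oadj_comp sT.
have ulE : ul_op E = R1 *o R1^*.
  by rewrite -fT oadj_comp /ul_op /E -fE !ocompA.
have urE : ur_op E = R1 *o R2^*.
  by rewrite -fT -sT oadj_comp /ur_op /E -fE -sE !ocompA.
have drE : dr_op E = R2 *o R2^*.
  by rewrite -sT oadj_comp /dr_op /E -sE !ocompA.
have [X1 R1X1] := closed_range_mpinv cR1.
have [D DX] : exists D, D = X1^* *o X1 by eexists.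
have Ds : D^* = D by rewrite DX oadj_gram.
have := mpinv_gram R1X1; rewrite -DX => DP; have [P1 P2 P3 P4] := DP.
have DE : mpinv (ul_op E) = D by rewrite ulE; exact: mpinvP.
have [P PE] : exists P, P = R1 *o R1^* *o D by eexists.
have Ps : P^* = P by rewrite PE P3.
have PE' : P = D *o (R1 *o R1^*).
  by rewrite -Ps PE !oadj_comp oadjK Ds.
have PD : P *o D = D by rewrite PE' P2.
have DP' : D *o P = D by rewrite PE ocompA P2.
(* [(1 - P) R1 R1^* = 0] improves to [(1 - P) R1 = 0]. *)
have PR1 : P *o R1 = R1.
  have h : R1 *o (R1^* *o (opid K1 - P)) = 0.
    by rewrite !compBr !compo1 PE' !ocompA -(ocompA _ R1) P1 subrr.
  have : R1^* *o (opid K1 - P) = 0.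
    by apply: gram_comp_eq0; rewrite oadjK -ocompA.
  move/(congr1 (@adj _ _ _ _)).
  rewrite oadj0 oadj_comp oadjK oadjB oadj1 Ps compBl comp1o => /eqP.
  by rewrite subr_eq0 => /eqP.
have [B BE] : exists B, B = D *o (R1 *o R2^*) by eexists.
have FE : F1 E = adj s - adj f *o B.
  rewrite /F1 col_opE -fE -sE DE urE -BE compo1 compNr addrC.
  by [].
have [F FE'] : exists F, F = F1 E by eexists.
rewrite -FE' in FE.
have FF : F^* *o F = opid K2 + B^* *o B.
  rewrite FE oadjB oadj_comp !oadjK compBl !compBr !ocompA ss sf.
  rewrite -[B^* *o f *o s^*]ocompA fs -[B^* *o f *o f^*]ocompA ff.
  by rewrite compo0 compo1 comp0o subr0 sub0r opprK.
have [S SE'] : exists S, S = schur E by eexists.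
have SE : S = R2 *o R2^* - R2 *o R1^* *o B.
  by rewrite SE' /schur DE urE drE oadj_comp oadjK BE !ocompA.
rewrite -SE' in cS.
have Ss : S^* = S.
  rewrite SE oadjB !oadj_comp !oadjK BE !oadj_comp !oadjK Ds !ocompA.
  by [].
have [N NE] : exists N, N = opinv (F^* *o F) by eexists.
have GN : is_opinv (F^* *o F) N.
  by rewrite NE FF; have [N0 GN0] := one_plus_gram_inv B; exact: opinvP GN0.
have FN : mpinv F^* = F *o N.
  have [GN1 _] := GN.
  have Ns : N^* = N by apply: opinv_selfadj GN; exact: oadj_gram.
  apply: mpinvP; rewrite /is_mpinv ocompA GN1 comp1o oadj1; split=> //.
    by rewrite -!ocompA [F^* *o _]ocompA GN1 compo1.
  by rewrite !oadj_comp oadjK Ns ocompA.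
have [X XE] : exists X, X = schur_g E by eexists.
have S_wmp : is_wmpinv N (F^* *o F) S X.
  rewrite XE /schur_g -FE' -SE' -NE; rewrite FF in GN *.
  apply: wmpinvP.
  - exact: one_plus_gram_inv_posdef GN.
  - exact: one_plus_gram_posdef GN.
  by have [Sd SSd] := closed_range_mpinv cS; have := weighted_mpinv GN Ss SSd.
rewrite /XR DE -XE -FE' -SE' FN diag_opE -fE.
have TF : T^* *o F = adj R2 - adj R1 *o B.
  by rewrite FE compBr ocompA Ts Tf.
apply: (penrose_formula (E := E) (e2 := s^*) (G := F^* *o F) (S := S)
  (Q := f^* *o (opid K1 - P) *o f)) => //.
(* The first row of [E F] vanishes because [P R1 = R1]; the second is [S]. *)
- have R1W : R1 *o (adj R2 - adj R1 *o B) = 0.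
    by rewrite compBr BE !ocompA -PE PR1 subrr.
  have R2W : R2 *o (adj R2 - adj R1 *o B) = S.
    by rewrite SE compBr !ocompA.
  by rewrite -ocompA TF TE compDl -!ocompA R1W R2W compo0 add0r.
- by rewrite FE oadjB oadj_comp !oadjK compBl -ocompA ss fs compo0 subr0.
- have zmod (V : zmodType) (a b c d : V) :
      a + b - (a - c) - (b - d) = c + d.
    by rewrite !opprB -[LHS]addrA [X in _ + X = _]addrACA -opprD [LHS]addrC subrK.
  have Bs : B^* = R2 *o R1^* *o D by rewrite BE !oadj_comp oadjK Ds.
  have := fst_snd_id K1 K2; rewrite -fE -sE => <-.
  rewrite compBr compBl compo1 FE oadjB oadj_comp !oadjK compBr.
  by rewrite [in RHS]ocompA zmod Bs PE !ocompA -(ocompA T) Tf TE !compDl.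
- by rewrite !oadj_comp oadjK Ds ocompA.
- by rewrite !oadj_comp oadjK oadjB oadj1 Ps ocompA.
- rewrite FE -!ocompA compBr fs (ocompA f) ff comp1o sub0r compNr.
  by rewrite compBl comp1o BE (ocompA P) PD subrr oppr0 compo0.
- by rewrite -!ocompA fT compBl comp1o PR1 subrr compo0.
- rewrite -!ocompA [f *o (_ *o _)]ocompA ff comp1o [D *o _]ocompA.
  by rewrite compBr compo1 DP' subrr comp0o compo0.
Qed.

End SchurFormula.

Theorem mainTheorem3 (R : realType) (A : cstarType R)
    (H1 H2 K1 K2 : hilbertModType A)
    (A11 : 'L(H1, K1)) (A12 : 'L(H2, K1))
    (A21 : 'L(H1, K2)) (A22 : 'L(H2, K2)) :
  let T := block_op A11 A12 A21 A22 in
  let E := T *o T^* in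
  closed_range (row_op A11 A12) ->
  closed_range T ->
  closed_range (schur E) ->
  mpinv T = T^* *o (diag_op (mpinv (ul_op E)) 0 *o XR E
                    + F1 E *o schur_g E *o (F1 E)^*).
Proof. by move=> T E cR1 _ cS; exact: mpinv_col. Qed.
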